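(* Let $A$ be an operator on a complex Hilbert space $H$. The following assertions are equivalent: (i) $A$ is selfadjoint and semibounded; (ii) there exist a Hilbert space $V$ continuously and densely embedded into $H$ and a symmetric, continuous sesquilinear form $a:V\times V\to\mathbb{C}$ such that $a_\lambda$ is essentially coercive for some $\lambda\in\mathbb{C}$ and $A$ is the operator associated with $a$ on $H$. In that case the form in (ii) is unique.
   Context: For $\lambda\in\mathbb{C}$, $a_\lambda(u,v):=a(u,v)-\lambda\langle u,v\rangle_H$ for $u,v\in V$. The operator associated with $a$ is the operator on $H$ with graph $\{(u,f)\in H\times H: u\in V,\ a(u,v)=\langle f,v\rangle_H \text{ for all } v\in V\}$. A continuous sesquilinear form $b:V\times V\to\mathbb{C}$ is essentially coercive if, for every sequence $(u_n)$ in $V$, $u_n\rightharpoonup 0$ weakly in $V$ and $b(u_n,u_n)\to 0$ imply $\|u_n\|_V\to 0$. Symmetric means $a(u,v)=\overline{a(v,u)}$ for all $u,v\in V$. Semibounded means bounded below or bounded above. Uniqueness of the form means that the form domain $V$ (as a linear subspace of $H$, with its norm up to equivalence) and the values of $a$ on $V\times V$ are determined by $A$. *)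

(* Defs.v *)
From HB Require Import structures.
From mathcomp Require Import all_boot all_order all_algebra sesquilinear complex.
From mathcomp Require Import all_classical all_reals.
From mathcomp Require Import topology normedtype.

Set Implicit Arguments.
Unset Strict Implicit.
Unset Printing Implicit Defensive.

Import Order.TTheory GRing.Theory Num.Theory.
Import numFieldNormedType.Exports.

Local Open Scope classical_set_scope.
Local Open Scope ring_scope.
Local Open Scope complex_scope.

(* Inner products and sesquilinear forms are linear in the first argument and
   antilinear in the second. *)
HB.mixin Record isHilbert (R : realType) V & CompleteNormedModule R[i] V := {
  inner : {dot V for (@Num.conj R[i])} ;
  inner_norm : forall u : V, inner u u = `|u| ^+ 2
}.

#[short(type="hilbertType")]
HB.structure Definition Hilbert (R : realType) :=
  {V of isHilbert R V & CompleteNormedModule R[i] V}.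

Notation "{ 'sesquilinear' V }" :=
  {bilinear V -> V -> _ | *%R & (@Num.conj _ \; *%R)} : ring_scope.

Section Operators.
Context {R : realType}.

Record operator (H : hilbertType R) := Operator {
  op_dom : set H ;
  op_fun :> H -> H ;
  op_dom0 : op_dom 0 ;
  op_domP : forall (c : R[i]) u v,
    op_dom u -> op_dom v -> op_dom (c *: u + v) ;
  op_linear : forall (c : R[i]) u v,
    op_dom u -> op_dom v -> op_fun (c *: u + v) = c *: op_fun u + op_fun v
}.

Context {H : hilbertType R}.
Implicit Types A : operator H.

Definition op_graph A : set (H * H) :=
  [set p | op_dom A p.1 /\ p.2 = A p.1].

Definition adjoint_graph A : set (H * H) :=
  [set p | forall v, op_dom A v -> inner (A v) p.1 = inner v p.2].

Definition selfadjoint A : Prop :=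
  dense (op_dom A) /\ op_graph A = adjoint_graph A.

(* In the order of R[i], x <= y means that y - x is real and nonnegative. *)
Definition bounded_below A : Prop :=
  exists c : R, forall u, op_dom A u -> c%:C * `|u| ^+ 2 <= inner (A u) u.

Definition bounded_above A : Prop :=
  exists c : R, forall u, op_dom A u -> inner (A u) u <= c%:C * `|u| ^+ 2.

Definition semibounded A : Prop := bounded_below A \/ bounded_above A.

End Operators.

Section Forms.
Context {R : realType} {V : hilbertType R}.
Implicit Types (a : {sesquilinear V}) (b : V -> V -> R[i]) (u : nat -> V).

Definition symmetric_sesquilinear a : Prop :=
  forall u v : V, a u v = Num.conj (a v u).

Definition continuous_sesquilinear a : Prop :=
  continuous (fun p : V * V => a p.1 p.2 : R[i]^o).

Definition weak_cvg0 u : Prop :=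
  forall f : {scalar V}, continuous (f : V -> R[i]^o) ->
    (f (u n) : R[i]^o) @[n --> \oo] --> (0 : R[i]^o).

Definition essentially_coercive b : Prop :=
  forall u, weak_cvg0 u -> (b (u n) (u n) : R[i]^o) @[n --> \oo] --> (0 : R[i]^o) ->
    (`|u n| : R[i]^o) @[n --> \oo] --> (0 : R[i]^o).

End Forms.

Section FormsInH.
Context {R : realType} {H : hilbertType R}.

(* The embedding of V into H is an injective linear map j; elements of V are
   regarded as elements of H through j. *)
Definition continuous_dense_embedding (V : hilbertType R)
    (j : {linear V -> H}) : Prop :=
  [/\ injective j, continuous j & dense (range j)].

Definition shifted_form (V : hilbertType R) (j : {linear V -> H})
    (a : {sesquilinear V}) (lambda : R[i]) (u v : V) : R[i] :=
  a u v - lambda * inner (j u) (j v).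

Definition form_graph (V : hilbertType R) (j : {linear V -> H})
    (a : {sesquilinear V}) : set (H * H) :=
  [set p | exists2 u : V, p.1 = j u & forall v, a u v = inner p.2 (j v)].

Definition form_of_operator (A : operator H) (V : hilbertType R)
    (j : {linear V -> H}) (a : {sesquilinear V}) : Prop :=
  [/\ continuous_dense_embedding j,
      symmetric_sesquilinear a,
      continuous_sesquilinear a,
      exists lambda : R[i], essentially_coercive (shifted_form j a lambda)
    & op_graph A = form_graph j a].

Definition same_form (V1 : hilbertType R) (j1 : {linear V1 -> H})
    (a1 : {sesquilinear V1}) (V2 : hilbertType R) (j2 : {linear V2 -> H})
    (a2 : {sesquilinear V2}) : Prop :=
  [/\ range j1 = range j2,
      exists c C : R, [/\ 0 < c, 0 < C &
        forall v1 v2, j1 v1 = j2 v2 -> c%:C * `|v1| <= `|v2| <= C%:C * `|v1| ]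
    & forall u1 v1 u2 v2, j1 u1 = j2 u2 -> j1 v1 = j2 v2 ->
        a1 u1 v1 = a2 u2 v2].

End FormsInH.

(* Main.v *)
(** A symmetric form with an essentially coercive shift is semicoercive:
    [s a(u,u) + omega |u|_H^2 >= alpha |u|_V^2] for a sign [s].  Indeed a bounded
    sequence of [V] that tends to 0 in [H] tends weakly to 0 in [V], so essential
    coercivity forces it to 0 in [V] as soon as [a(u_n,u_n)] tends to 0; were
    neither [a] nor [-a] semicoercive, interpolating between two bad unit vectors
    would give a unit-sized sequence violating this.  Lax-Milgram for
    [s a + omega <.,.>_H] then makes [A + s omega] surjective, and a symmetric
    operator with a surjective real shift is selfadjoint.  The same form shows
    that the domain of [A] is dense in [V]; as all forms associated with [A]
    agree on that domain and their norms are equivalent there, the form is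
    unique.  Conversely, if [s A + k >= 1], let [T] be its inverse and [J] the
    square root of [T]: take [V = H] embedded by [J], and
    [a(u,v) = s (<u,v> - k <J u, J v>)]. *)
Require Import Defs.
From HB Require Import structures.
From mathcomp Require Import all_boot all_order all_algebra sesquilinear complex.
From mathcomp Require Import all_classical all_reals.
From mathcomp Require Import topology normedtype sequences.
From mathcomp Require Import ring lra.

Set Implicit Arguments.
Unset Strict Implicit.
Unset Printing Implicit Defensive.

Import Order.TTheory GRing.Theory Num.Theory.
Import numFieldNormedType.Exports.

Local Open Scope classical_set_scope.
Local Open Scope ring_scope.
Local Open Scope complex_scope.

(** * Limits of real sequences *)

Section RealSequences.
Context {R : realType}.
Implicit Types x y : nat -> R.

Lemma cvg_dominated x y (l K : R) : y @ \oo --> 0 ->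
  (forall n, `|x n - l| <= K * y n) -> x @ \oo --> l.
Proof.
move=> y0 xy; apply/cvgrPdist_le => e e0.
have Ky0 : (fun n => K * y n) @ \oo --> 0 by rewrite -(mulr0 K);
  exact: cvgMl_tmp.
move/cvgrPdist_le : Ky0 => /(_ e e0); apply: filterS => n /=.
rewrite sub0r normrN distrC => H; apply: le_trans (xy n) _.
by apply: le_trans H; rewrite ler_norm.
Qed.

Lemma cvg_divSn (K : R) : (fun n => K / n.+1%:R) @ \oo --> (0 : R).
Proof.
by rewrite -(mulr0 K); apply: cvgMl_tmp; exact: cvg_harmonic.
Qed.

Lemma cvg_le0_cst x (K : R) : x @ \oo --> 0 -> (forall n, K <= x n) -> K <= 0.
Proof. by move=> x0 Kx; apply: (ler_cvg_to (cvg_cst K) x0); exact: nearW. Qed.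

Lemma cvg_real_unique x (k l : R) : x @ \oo --> k -> x @ \oo --> l -> k = l.
Proof. by move=> /(cvg_lim (@Rhausdorff R)) <- /(cvg_lim (@Rhausdorff R)). Qed.

End RealSequences.

(** * Real and imaginary parts *)

Section ComplexNumbers.
Context {R : realType}.
Implicit Types z w : R[i].

Lemma ReD z w : complex.Re (z + w) = complex.Re z + complex.Re w.
Proof. by case: z w => [? ?] [? ?]. Qed.

Lemma ReN z : complex.Re (- z) = - complex.Re z.
Proof. by case: z. Qed.

Lemma ReZ (r : R) z : complex.Re (r%:C * z) = r * complex.Re z.
Proof. by case: z => a b /=; rewrite mul0r subr0. Qed.

Lemma Re_conj z : complex.Re (Num.conj z) = complex.Re z.
Proof. by case: z. Qed.

Lemma Im_conj z : complex.Im (Num.conj z) = - complex.Im z.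
Proof. by case: z. Qed.

Lemma conj_rC (r : R) : Num.conj r%:C = r%:C :> R[i].
Proof. exact: conjc_real. Qed.

Lemma complex_eqP z w :
  complex.Re z = complex.Re w -> complex.Im z = complex.Im w -> z = w.
Proof. by case: z w => [? ?] [? ?] /= -> ->. Qed.

Lemma normc_le z : complex.Re `|z| <= `|complex.Re z| + `|complex.Im z|.
Proof.
rewrite normc_def /=; set a := complex.Re z; set b := complex.Im z.
rewrite -[leRHS]ger0_norm ?addr_ge0// -sqrtr_sqr ler_sqrt ?sqr_ge0//.
rewrite -[a ^+ 2]real_normK ?num_real// -[b ^+ 2]real_normK ?num_real//.
have := normr_ge0 a; have := normr_ge0 b.
move: `|a| `|b| => p q; nra.
Qed.

Lemma normc_ge_Re z : `|complex.Re z| <= complex.Re `|z|.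
Proof.
rewrite normc_def /= -sqrtr_sqr ler_sqrt ?lerDl ?addr_ge0 ?sqr_ge0//.
Qed.

End ComplexNumbers.

(** * Norms as real numbers, and norm convergence *)

Definition nrm {R : realType} {V : normedModType R[i]} (u : V) : R :=
  complex.Re `|u|.

(** Norms take values in [R[i]]; with their real parts, convergence becomes a limit of reals, open
    to [cvg_dominated] and real arithmetic. [ncvgP] links it back to convergence of filters. *)
Definition ncvg {R : realType} {V : normedModType R[i]}
  (u : nat -> V) (l : V) := (fun n => nrm (u n - l)) @ \oo --> (0 : R).

Section RealNorm.
Context {R : realType} {V : normedModType R[i]}.
Implicit Types u v w : V.

Lemma nrmE u : `|u| = (nrm u)%:C.
Proof. by rewrite RRe_real ?normr_real. Qed.

Lemma nrm_ge0 u : 0 <= nrm u.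
Proof. by rewrite -ler0c -nrmE. Qed.

Lemma nrm0 : nrm (0 : V) = 0.
Proof. by rewrite /nrm normr0. Qed.

Lemma nrm_eq0 u : nrm u = 0 -> u = 0.
Proof. by move=> u0; apply/eqP; rewrite -normr_eq0 nrmE u0. Qed.

Lemma nrm_gt0 u : u != 0 -> 0 < nrm u.
Proof.
by rewrite lt_def nrm_ge0 andbT; apply: contra_neq; exact: nrm_eq0.
Qed.

Lemma nrmZc (c : R[i]) u : nrm (c *: u) = complex.Re `|c| * nrm u.
Proof.
rewrite {1}/nrm normrZ (nrmE u).
have -> : `|c| = (complex.Re `|c|)%:C by rewrite RRe_real ?normr_real.
by rewrite -rmorphM.
Qed.

Lemma nrmZ (r : R) u : nrm (r%:C *: u) = `|r| * nrm u.
Proof.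
by rewrite nrmZc normc_def /= expr0n addr0 sqrtr_sqr.
Qed.

Lemma nrmN u : nrm (- u) = nrm u.
Proof. by rewrite /nrm normrN. Qed.

Lemma nrmD u v : nrm (u + v) <= nrm u + nrm v.
Proof.
by have := ler_normD u v; rewrite !nrmE -rmorphD lecR.
Qed.

Lemma nrmB u v : nrm (u - v) <= nrm u + nrm v.
Proof. by rewrite -(nrmN v) nrmD. Qed.

Lemma nrm_distC u v : nrm (u - v) = nrm (v - u).
Proof. by rewrite -nrmN opprB. Qed.

Lemma nrm_dist u v w : nrm (u - w) <= nrm (u - v) + nrm (v - w).
Proof. by apply: le_trans (nrmD _ _); rewrite addrA subrK. Qed.

Lemma ler_nrmB u v : `|nrm u - nrm v| <= nrm (u - v).
Proof.
rewrite ler_norml; apply/andP; split.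
  by have := nrmD (v - u) u; rewrite subrK nrm_distC; lra.
by have := nrmD (u - v) v; rewrite subrK; lra.
Qed.

Lemma nrm_ltC (u : V) (r : R) : (`|u| < r%:C) = (nrm u < r).
Proof. by rewrite nrmE ltcR. Qed.

Lemma gtc0_real (e : R[i]) : 0 < e -> exists2 r : R, 0 < r & e = r%:C.
Proof.
move=> e0; exists (complex.Re e); last by rewrite RRe_real// gtr0_real.
by move: e0; rewrite ltcE => /andP[].
Qed.

Lemma ncvg_nrm (u_ : nat -> V) u : ncvg u_ u -> (nrm \o u_) @ \oo --> nrm u.
Proof.
by move=> uu; apply: (cvg_dominated (K := 1) uu) => n; rewrite mul1r ler_nrmB.
Qed.

Lemma ncvg_unique (u_ : nat -> V) u v : ncvg u_ u -> ncvg u_ v -> u = v.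
Proof.
move=> uu uv; apply/eqP; rewrite -subr_eq0; apply/eqP/nrm_eq0/le_anti.
rewrite nrm_ge0 andbT.
apply: (@cvg_le0_cst _ (fun n => nrm (u_ n - u) + nrm (u_ n - v))).
  by rewrite -(addr0 0); exact: cvgD.
by move=> n; rewrite (nrm_distC (u_ n) u); exact: nrm_dist.
Qed.

Lemma ncvgD (u_ v_ : nat -> V) u v : ncvg u_ u -> ncvg v_ v ->
  ncvg (fun n => u_ n + v_ n) (u + v).
Proof.
move=> uu vv; apply: (@cvg_dominated _ _
  (fun n => nrm (u_ n - u) + nrm (v_ n - v)) _ 1).
  by rewrite -(addr0 0); exact: cvgD.
move=> n; rewrite subr0 mul1r ger0_norm ?nrm_ge0// opprD addrACA.
exact: nrmD.
Qed.

Lemma ncvgZ (c : R[i]) (u_ : nat -> V) u : ncvg u_ u ->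
  ncvg (fun n => c *: u_ n) (c *: u).
Proof.
move=> uu; apply: (cvg_dominated (K := complex.Re `|c|) uu) => n.
by rewrite subr0 ger0_norm ?nrm_ge0// -scalerBr nrmZc.
Qed.

Lemma ncvgP (u_ : nat -> V) u : ncvg u_ u <-> u_ @ \oo --> u.
Proof.
split=> [uu|uu].
  apply/cvgrPdist_lt => _ /gtc0_real[e e0 ->].
  move/cvgrPdist_lt : uu => /(_ e e0); apply: filterS => n.
  by rewrite sub0r normrN ger0_norm ?nrm_ge0// distrC nrm_ltC.
apply/cvgrPdist_lt => e e0.
move/cvgrPdist_lt : uu => /(_ e%:C); rewrite ltcR => /(_ e0).
apply: filterS => n.
by rewrite sub0r normrN ger0_norm ?nrm_ge0// distrC nrm_ltC.
Qed.

Lemma dense_approx (D : set V) : dense D <->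
  forall x, exists2 d : nat -> V, (forall n, D (d n)) & ncvg d x.
Proof.
split=> [denseD x|Dx O [x Ox]].
  have /choice[d dP] n : exists d, D d /\ nrm (d - x) <= 1 / n.+1%:R.
    have e0 : 0 < ((1 / n.+1%:R : R))%:C by rewrite ltcR divr_gt0.
    have [||d [xd Dd]] := denseD (ball x ((1 / n.+1%:R : R))%:C).
    - by exists x; exact: ballxx.
    - exact: ball_open.
    - exists d; split => //; apply: ltW.
      by move: xd; rewrite -ball_normE /ball_/= nrm_ltC nrm_distC.
  exists d => [n|]; first by case: (dP n).
  apply: (cvg_dominated (K := 1) (cvg_divSn 1)) => n.
  by rewrite subr0 ger0_norm ?nrm_ge0// mul1r; case: (dP n).
rewrite openE => /(_ _ Ox).
have [d Dd /ncvgP dx] := Dx x => /dx [N _ /(_ N (leqnn N)) ON].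
by exists (d N).
Qed.

End RealNorm.

(** * Continuity and boundedness of linear maps *)

Section Bounded.
Context {R : realType} {V W : normedModType R[i]}.

(** Continuity at 0 sends a ball of radius [e] into the unit ball; rescaling [u] to norm [e / 2]
    gives the constant [2 / e]. *)
Lemma continuous_bounded (f : {linear V -> W}) : continuous f ->
  exists2 K : R, 0 < K & forall u, nrm (f u) <= K * nrm u.
Proof.
have lt01 : 0 < (1 : R)%:C by rewrite ltcR.
move=> /(_ 0)/cvgrPdist_lt/(_ _ lt01); rewrite linear0.
move=> /nbhs_norm0P[/= _ /gtc0_real[e e0 ->] fe].
exists (2 / e) => [|u]; first by rewrite divr_gt0.
have [->|u0] := eqVneq u 0; first by rewrite linear0 !nrm0 mulr0.
have nu := nrm_gt0 u0.
have k0 : 0 < e / (2 * nrm u) by rewrite divr_gt0// mulr_gt0.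
have /= := fe ((e / (2 * nrm u))%:C *: u).
rewrite sub0r normrN !nrm_ltC linearZ !nrmZ (gtr0_norm k0).
have -> : e / (2 * nrm u) * nrm u = e / 2 by field; rewrite gt_eqF.
rewrite ltr_pdivrMr// mulr_natr mulr2n ltrDl => /(_ e0).
rewrite mulrAC ltr_pdivrMr ?mulr_gt0// mul1r => h.
by rewrite mulrAC ler_pdivlMr// mulrC ltW.
Qed.

Lemma bounded_continuous (f : {linear V -> W}) (K : R) :
  (forall u, nrm (f u) <= K * nrm u) -> continuous f.
Proof.
move=> fK u; apply/cvgrPdist_lt => _ /gtc0_real[e e0 ->].
(* [K] may be zero or negative, so [|K| + 1] serves as a positive Lipschitz constant. *)
have K0 : 0 < `|K| + 1 by rewrite ltr_wpDl.
have d0 : 0 < (e / (`|K| + 1))%:C by rewrite ltcR divr_gt0.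
near=> v; rewrite nrm_ltC -linearB.
apply: le_lt_trans (fK _) _.
apply: (@le_lt_trans _ _ ((`|K| + 1) * nrm (u - v))).
  by rewrite ler_wpM2r ?nrm_ge0// (le_trans (ler_norm _))// lerDl.
rewrite mulrC -ltr_pdivlMr// -nrm_ltC; near: v.
by move: d0; move: (e / _)%:C; apply/cvgrPdist_lt; exact: cvg_id.
Unshelve. all: by end_near. Qed.

End Bounded.

(** * Hermitian forms on Hilbert spaces *)

(** A predicate on bare functions, so that the inner product, bundled forms and combinations such as
    [s a + omega <.,.>] share the same lemmas. Antilinearity in the second argument follows from the
    two clauses. *)
Definition hermitian_form {R : realType} {V : lmodType R[i]}
    (b : V -> V -> R[i]) : Prop :=
  (forall (c : R[i]) u v w, b (c *: u + v) w = c * b u w + b v w) /\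
  (forall u v, b u v = Num.conj (b v u)).

Definition submodule {R : realType} {V : lmodType R[i]} (D : set V) : Prop :=
  D 0 /\ forall (c : R[i]) u v, D u -> D v -> D (c *: u + v).

Section HermitianForms.
Context {R : realType} {V : lmodType R[i]} (b : V -> V -> R[i]).
Hypothesis bh : hermitian_form b.
Implicit Types u v w : V.
Local Notation rb u v := (complex.Re (b u v)).

Lemma hermitianDl u v w : b (u + v) w = b u w + b v w.
Proof. by have := bh.1 1 u v w; rewrite scale1r mul1r. Qed.

Lemma hermitian0l w : b 0 w = 0.
Proof. by have := hermitianDl 0 0 w; rewrite addr0 => /eqP;
  rewrite addrC -subr_eq subrr => /eqP. Qed.

Lemma hermitianZl c u w : b (c *: u) w = c * b u w.
Proof. by have := bh.1 c u 0 w; rewrite hermitian0l !addr0. Qed.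

Lemma hermitianNl u w : b (- u) w = - b u w.
Proof. by rewrite -scaleN1r hermitianZl mulN1r. Qed.

Lemma hermitianBl u v w : b (u - v) w = b u w - b v w.
Proof. by rewrite hermitianDl hermitianNl. Qed.

Lemma hermitianDr u v w : b w (u + v) = b w u + b w v.
Proof. by rewrite bh.2 hermitianDl rmorphD /= -!bh.2. Qed.

Lemma hermitian0r w : b w 0 = 0.
Proof. by rewrite bh.2 hermitian0l rmorph0. Qed.

Lemma hermitianZr c u w : b w (c *: u) = Num.conj c * b w u.
Proof. by rewrite bh.2 hermitianZl rmorphM /= -bh.2. Qed.

Lemma hermitianNr u w : b w (- u) = - b w u.
Proof. by rewrite -scaleN1r hermitianZr rmorphN1 mulN1r. Qed.

Lemma hermitianBr u v w : b w (u - v) = b w u - b w v.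
Proof. by rewrite bh.2 hermitianBl rmorphB /= -!bh.2. Qed.

Lemma Re_hermitianC u v : rb u v = rb v u.
Proof. by rewrite bh.2 Re_conj. Qed.

Lemma hermitian_diag u : b u u = (rb u u)%:C.
Proof.
apply: complex_eqP => //=.
by have := congr1 (@complex.Im R) (bh.2 u u); rewrite Im_conj; lra.
Qed.

Lemma Re_hermitianZi u w : rb ('i *: u) w = - complex.Im (b u w).
Proof. by rewrite hermitianZl mulrC ReiNIm. Qed.

Lemma Re_hermitian_comb (r t : R) u v :
  rb (r%:C *: u + t%:C *: v) (r%:C *: u + t%:C *: v) =
  r ^+ 2 * rb u u + 2 * r * t * rb u v + t ^+ 2 * rb v v.
Proof.
rewrite !(hermitianDl, hermitianDr, hermitianZl, hermitianZr) !conj_rC.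
rewrite !(ReD, ReZ) (Re_hermitianC v u); ring.
Qed.

End HermitianForms.

(** The imaginary part at [u] is minus the real part at ['i *: u]. Limits and minimization thus only
    have to deal with real parts. *)
Lemma eq_Re_linear {R : realType} {V : lmodType R[i]} (D : set V)
    (f g : V -> R[i]) : submodule D ->
  (forall c u, D u -> f (c *: u) = c * f u) ->
  (forall c u, D u -> g (c *: u) = c * g u) ->
  (forall u, D u -> complex.Re (f u) = complex.Re (g u)) ->
  forall u, D u -> f u = g u.
Proof.
move=> [D0 DP] fZ gZ fg u Du; apply: complex_eqP; first exact: fg.
have /fg : D ('i *: u) by rewrite -[_ *: u]addr0; exact: DP.
by rewrite fZ// gZ// !(mulrC 'i) !ReiNIm => /oppr_inj.
Qed.

Section Hilbert.
Context {R : realType} {V : hilbertType R}.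
Implicit Types u v w : V.
Local Notation rdot u v := (complex.Re (inner u v)).

Lemma inner_hermitian : hermitian_form (inner : V -> V -> R[i]).
Proof.
split=> [c u v w|u v]; first by rewrite linearPl.
by rewrite (@hermitian_subproof _ _ _ _ inner u v)/= expr0 mul1r.
Qed.

Lemma rdot_nrm u : rdot u u = nrm u ^+ 2.
Proof. by rewrite inner_norm nrmE -rmorphXn. Qed.

Lemma nrm_comb (r t : R) u v : nrm (r%:C *: u + t%:C *: v) ^+ 2 =
  r ^+ 2 * nrm u ^+ 2 + 2 * r * t * rdot u v + t ^+ 2 * nrm v ^+ 2.
Proof. by rewrite -!rdot_nrm (Re_hermitian_comb inner_hermitian). Qed.

(** Cauchy-Schwarz: expanding the squared norms of [nrm v u + nrm u v] and [nrm v u - nrm u v] gives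
    both bounds multiplied by [nrm u * nrm v], whence the separate case where this product is 0. *)
Lemma rdot_le u v : `|rdot u v| <= nrm u * nrm v.
Proof.
have := nrm_ge0 u; have := nrm_ge0 v.
have := nrm_comb (nrm v) (- nrm u) u v; have := nrm_comb (nrm v) (nrm u) u v.
have := sqr_ge0 (nrm ((nrm v)%:C *: u + (nrm u)%:C *: v)).
have := sqr_ge0 (nrm ((nrm v)%:C *: u + (- nrm u)%:C *: v)).
move: (nrm (_ + _) ^+ 2) (nrm (_ + _) ^+ 2) => A B A0 B0 eA eB v0 u0.
rewrite ler_norml.
have [uv|uv] := eqVneq (nrm u * nrm v) 0; last first.
  have {}uv : 0 < nrm u * nrm v by rewrite lt_def uv mulr_ge0.
  by rewrite -(ler_pM2l uv) -(ler_pM2l uv _ (nrm u * nrm v)); apply/andP;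
    split; nra.
have : rdot u v = 0.
  move/eqP : uv; rewrite mulf_eq0 => /orP[] /eqP/nrm_eq0 ->.
    by rewrite (hermitian0l inner_hermitian).
  by rewrite (hermitian0r inner_hermitian).
by rewrite uv => ->; rewrite oppr0 lexx.
Qed.

Lemma inner_eq0 u : (forall v, inner u v = 0) -> u = 0.
Proof.
by move=> /(_ u) u0; apply: nrm_eq0; apply/eqP; rewrite -sqrf_eq0 -rdot_nrm u0.
Qed.

(** Completeness with the modulus [d m + d n], the shape in which all Cauchy estimates below
    arise. *)
Lemma ncauchy_cvg (u_ : nat -> V) (d : nat -> R) : d @ \oo --> 0 ->
  (forall m n, nrm (u_ m - u_ n) <= d m + d n) -> exists l, ncvg u_ l.
Proof.
move=> d0 ud.
suff /cauchy_cvg/cvg_ex[l] : cauchy (u_ @ \oo) by exists l; exact/ncvgP.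
apply/cauchy_ballP => _ /gtc0_real[e e0 ->].
move/cvgrPdist_lt : d0 => /(_ (e / 2)); rewrite divr_gt0// => /(_ isT)[N _ dN].
near_simpl; exists ([set n | (N <= n)%N], [set n | (N <= n)%N]) => /=.
  by split; exists N.
move=> [m n] [/= Nm Nn].
rewrite -ball_normE /ball_/= nrm_ltC; apply: le_lt_trans (ud _ _) _.
by have := dN _ Nm; have := dN _ Nn; rewrite /= !sub0r !normrN; clear ud;
  have := ler_norm (d m); have := ler_norm (d n); lra.
Qed.

(** * Minimization of coercive quadratic functionals *)

Section Variational.
Variables (b : V -> V -> R[i]) (alpha M : R).
Hypothesis bh : hermitian_form b.
Hypothesis alpha0 : 0 < alpha.
Hypothesis b_coercive : forall u, alpha * nrm u ^+ 2 <= complex.Re (b u u).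
Hypothesis b_bounded :
  forall u v, `|complex.Re (b u v)| <= M * (nrm u * nrm v).

(* [d] is the limit of a minimizing sequence in [D] of the functional
   [b u u - 2 Re (l u)], which is Cauchy by the parallelogram identity. *)
Lemma variational (D : set V) (l : V -> R[i]) (K : R) : submodule D ->
  (forall c u v, l (c *: u + v) = c * l u + l v) ->
  (forall u, `|complex.Re (l u)| <= K * nrm u) ->
  exists (d_ : nat -> V) (d : V), [/\ forall n, D (d_ n), ncvg d_ d
    & forall v, D v -> b v d = l v].
Proof.
move=> Dsub llin lK; have [D0 DP] := Dsub.
pose q u := complex.Re (b u u) - 2 * complex.Re (l u).
have l0 : l 0 = 0.
  by have := llin 1 0 0; rewrite scale1r mul1r addr0 => /eqP;
    rewrite addrC -subr_eq subrr => /eqP.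
have lZ c u : l (c *: u) = c * l u by have := llin c u 0; rewrite l0 !addr0.
have lcomb (r t : R) u v :
    complex.Re (l (r%:C *: u + t%:C *: v)) =
    r * complex.Re (l u) + t * complex.Re (l v).
  by rewrite llin lZ ReD !ReZ.
(* Completing the square in [alpha n^2 - 2 K n], with [n] the norm of [u]. *)
have qlb u : - (K ^+ 2 / alpha) <= q u.
  rewrite /q; have := b_coercive u; have := lK u.
  rewrite ler_norml => /andP[_]; set n := nrm u => h1 h2.
  have h3 := sqr_ge0 (alpha * n - K).
  have : K ^+ 2 / alpha * alpha = K ^+ 2 by rewrite divfK// gt_eqF.
  move: (K ^+ 2 / alpha) => k hk.
  have : 0 <= alpha * (k + alpha * n ^+ 2 - 2 * (K * n)) by nra.
  by rewrite pmulr_rge0//; lra.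
pose Q := q @` D.
have Qinf : has_inf Q.
  split; first by exists (q 0), 0.
  by exists (- (K ^+ 2 / alpha)) => _ [u _ <-].
pose m := inf Q.
have mq u : D u -> m <= q u by move=> Du; apply: ge_inf;
  [exact: Qinf.2|exists u].
(* This size makes [dist] bound the distance of [d_ i] and [d_ j] by [1/(i+1) + 1/(j+1)]. *)
pose eps n : R := alpha / 4 * (n.+1%:R^-1) ^+ 2.
have /choice[d_ dP] n : exists u, D u /\ q u < m + eps n.
  have e0 : 0 < eps n.
    by apply: mulr_gt0; [exact: divr_gt0|rewrite exprn_gt0// invr_gt0].
  by have [_ [u Du <-] qu] := inf_adherent e0 Qinf; exists u.
have half2 : (2^-1 : R) + 2^-1 = 1 by lra.
(* The midpoint of [u] and [v] stays in [D], so [q] is at least [m] there. *)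
have dist u v : D u -> D v ->
    alpha * nrm (u - v) ^+ 2 <= 2 * (q u - m) + 2 * (q v - m).
  move=> Du Dv; apply: le_trans (b_coercive _) _.
  have : m <= q ((2^-1)%:C *: u + (2^-1)%:C *: v).
    apply/mq; apply: (DP) => //; rewrite -[_ *: v]addr0; exact: DP.
  have -> : u - v = 1%:C *: u + (-1)%:C *: v by rewrite rmorphN1 scale1r
    scaleN1r.
  by rewrite /q !(Re_hermitian_comb bh) !lcomb; lra.
have inv0 n : 0 <= (n.+1%:R : R)^-1 by rewrite invr_ge0.
have [d dd] : exists d, ncvg d_ d.
  apply: (ncauchy_cvg cvg_harmonic) => i j /=.
  have := dist _ _ (dP i).1 (dP j).1; have := (dP i).2; have := (dP j).2.
  rewrite /eps; have := inv0 i; have := inv0 j; have := nrm_ge0 (d_ i - d_ j).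
  move: (_^-1) (_^-1) (nrm _) (q _) (q _) => y x n qi qj n0 y0 x0 h1 h2 h3.
  rewrite -(@ler_pXn2r _ 2)// ?nnegrE ?addr_ge0//.
  rewrite -(ler_pM2l alpha0).
  have a0 := ltW alpha0; have := mulr_ge0 a0 (mulr_ge0 x0 y0).
  have := mulr_ge0 a0 (sqr_ge0 x); have := mulr_ge0 a0 (sqr_ge0 y); lra.
have limb v : (fun n => complex.Re (b v (d_ n))) @ \oo --> complex.Re (b v d).
  apply: (cvg_dominated (K := M * nrm v) dd) => n.
  rewrite -ReN -ReD -(hermitianBr bh) -mulrA; exact: b_bounded.
have eps_le n : eps n <= alpha / n.+1%:R.
  rewrite /eps; have := inv0 n.
  have : n.+1%:R^-1 <= 1 :> R by rewrite invf_le1// ler1n.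
  move: (_^-1) => x x1 x0; have a0 := ltW alpha0.
  have x1' : 0 <= 1 - x by rewrite subr_ge0.
  have := mulr_ge0 a0 (mulr_ge0 x0 x1'); have := mulr_ge0 a0 x0; lra.
(* The first variation at [d] in the direction [v]. As [d] is only a limit of points of [D], the
   inequality [m <= q (d_ n + t v)] is written for [d_ n] and passed to the limit. *)
have crit v (t : R) : D v ->
    0 <= 2 * t * (complex.Re (b v d) - complex.Re (l v)) +
      t ^+ 2 * complex.Re (b v v).
  move=> Dv; set r := _ + _.
  rewrite -oppr_le0; apply: (@cvg_le0_cst _ (fun n => alpha / n.+1%:R +
     2 * t * (complex.Re (b v (d_ n)) - complex.Re (b v d)))).
    rewrite -(addr0 0); apply: cvgD; first exact: cvg_divSn.
    rewrite -(mulr0 (2 * t)) -(subrr (complex.Re (b v d))).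
    by apply: cvgMl_tmp; apply: cvgB => //; exact: cvg_cst.
  move=> n; have /mq : D (1%:C *: d_ n + t%:C *: v).
    apply: (DP); first exact: (dP n).1.
    rewrite -[_ *: v]addr0; exact: DP.
  have := (dP n).2; have := eps_le n; rewrite /r.
  rewrite /q (Re_hermitian_comb bh) lcomb (Re_hermitianC bh _ v).
  clear; move: (m) (eps n) (alpha / _) (complex.Re _) (complex.Re _) => m' x y.
  move: (complex.Re _) (complex.Re _) (complex.Re _) (complex.Re _).
  by move=> *; lra.
exists d_, d; split => //; first by move=> n; case: (dP n).
apply: eq_Re_linear => // [c u _|]; first by rewrite (hermitianZl bh).
move=> v Dv.
apply/eqP; rewrite -subr_eq0; apply/eqP.
have vv0 : 0 <= complex.Re (b v v).
  by apply: le_trans (b_coercive v); rewrite mulr_ge0 ?sqr_ge0// ltW.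
have := crit v; move: vv0.
move: (complex.Re (b v d) - _) (complex.Re (b v v)) => x y y0 h.
have c0 : 0 < y + 1 by rewrite ltr_wpDl.
(* The minimizer [- x / y] is replaced by [- x / (y + 1)], which makes sense for [y = 0] too; the
   value [- x^2 (y + 2) / (y + 1)^2] is nonnegative only if [x = 0]. *)
have := h (- x / (y + 1)) Dv; set z := _ + _ => z0.
have := mulr_ge0 z0 (sqr_ge0 (y + 1)).
have -> : z * (y + 1) ^+ 2 = - (x ^+ 2 * (y + 2)).
  by rewrite /z; field; rewrite gt_eqF.
rewrite oppr_ge0 pmulr_lle0 ?ltr_wpDl// => x0.
by apply/eqP; rewrite -sqrf_eq0 eq_le x0 sqr_ge0.
Qed.

Lemma submoduleT : submodule [set: V].
Proof. by []. Qed.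

Lemma lax_milgram (l : V -> R[i]) (K : R) :
  (forall c u v, l (c *: u + v) = c * l u + l v) ->
  (forall u, `|complex.Re (l u)| <= K * nrm u) ->
  exists d, forall v, b v d = l v.
Proof.
move=> llin lK; have [_ [d [_ _ bl]]] := variational submoduleT llin lK.
by exists d => v; exact: bl.
Qed.

(** Minimizing with [l = b(., x)] projects [x] onto the closure of [D] for the energy [b]; the
    defect [d - x] is [b]-orthogonal to [D], hence zero. A general [b] serves both density in [H]
    and density in the form domain. *)
Lemma approx_of_orthogonal0 (D : set V) : submodule D ->
  (forall w, (forall v, D v -> b v w = 0) -> w = 0) ->
  forall x, exists2 d_ : nat -> V, (forall n, D (d_ n)) & ncvg d_ x.
Proof.
move=> Dsub D0 x.
have [c u v|u|d_ [d [Dd dd bd]]] := @variational D (b ^~ x) (M * nrm x) Dsub.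
- by rewrite bh.1.
- by rewrite -mulrA (mulrC (nrm x)).
suff <- : d = x by exists d_.
apply/eqP; rewrite -subr_eq0; apply/eqP/D0 => v Dv.
by rewrite (hermitianBr bh) bd// subrr.
Qed.

End Variational.

Lemma inner_coercive u : 1 * nrm u ^+ 2 <= complex.Re (inner u u).
Proof. by rewrite rdot_nrm mul1r. Qed.

Lemma inner_bounded u v : `|complex.Re (inner u v)| <= 1 * (nrm u * nrm v).
Proof. by rewrite mul1r rdot_le. Qed.

Lemma riesz (l : V -> R[i]) (K : R) :
  (forall c u v, l (c *: u + v) = c * l u + l v) ->
  (forall u, `|complex.Re (l u)| <= K * nrm u) ->
  exists d, forall v, l v = inner v d.
Proof.
move=> llin lK.
have [d dl] := lax_milgram inner_hermitian ltr01 inner_coercive inner_bounded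
  llin lK.
by exists d.
Qed.

Lemma dense_of_orthogonal0 (D : set V) : submodule D ->
  (forall w, (forall v, D v -> inner v w = 0) -> w = 0) -> dense D.
Proof.
move=> Dsub D0; apply/dense_approx.
exact: (approx_of_orthogonal0 inner_hermitian ltr01 inner_coercive
  inner_bounded).
Qed.

Lemma cvg_rdotr (u_ : nat -> V) u v : ncvg u_ u ->
  (fun n => rdot v (u_ n)) @ \oo --> rdot v u.
Proof.
move=> uu; apply: (cvg_dominated (K := nrm v) uu) => n.
by rewrite -ReN -ReD -(hermitianBr inner_hermitian) rdot_le.
Qed.

End Hilbert.

(** * Selfadjoint operators *)

Section SelfadjointOperators.
Context {R : realType} {H : hilbertType R}.
Implicit Types (A : operator H) (f u v w : H).
Let ih := @inner_hermitian R H.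

Lemma op_dom_submodule A : submodule (op_dom A).
Proof. by split=> [|c u v]; [exact: op_dom0|exact: op_domP]. Qed.

Lemma op0 A : A 0 = 0.
Proof.
have D0 := op_dom0 A.
by have := op_linear (-1) D0 D0; rewrite scaler0 addr0 scaleN1r addNr.
Qed.

Lemma op_domB A u v : op_dom A u -> op_dom A v -> op_dom A (u - v).
Proof. by move=> Du Dv; rewrite addrC -scaleN1r; exact: op_domP. Qed.

Lemma selfadjoint_symmetric A u v : selfadjoint A -> op_dom A u -> op_dom A v ->
  inner (A u) v = inner u (A v).
Proof.
move=> [_ sA] Du Dv.
have vA : adjoint_graph A (v, A v) by rewrite -sA.
exact: (vA u Du).
Qed.

(* For [v] in the domain, [(A + k) v] is orthogonal to [x - u], where
   [(A + k) u = y + k x] and [(x, y)] lies in the graph of the adjoint. *)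
Lemma selfadjoint_of_surjective A (k : R) :
  (forall u v, op_dom A u -> op_dom A v -> inner (A u) v = inner u (A v)) ->
  (forall f, exists2 u, op_dom A u & A u + k%:C *: u = f) ->
  selfadjoint A.
Proof.
move=> sym surj.
have symk u v : op_dom A u -> op_dom A v ->
    inner (A u + k%:C *: u) v = inner u (A v + k%:C *: v).
  move=> Du Dv; rewrite (hermitianDl ih) (hermitianDr ih) sym//.
  by rewrite (hermitianZl ih) (hermitianZr ih) conj_rC.
split.
  apply: dense_of_orthogonal0; first exact: op_dom_submodule.
  (* With [w = (A + k) u], symmetry turns orthogonality of [w] to the domain into orthogonality of
     [u] to the range of [A + k], which is everything. *)
  move=> w w0; have [u Du uw] := surj w.
  suff u0 : u = 0 by rewrite -uw u0 op0 scaler0 addr0.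
  apply: inner_eq0 => v; have [x Dx <-] := surj v.
  by rewrite -symk// uw ih.2 w0// rmorph0.
apply/seteqP; split=> [[x y] [/= Dx ->] v Dv /=|[x y] /= xy]; first exact: sym.
have [u Du uE] := surj (y + k%:C *: x).
have xu : x = u.
  apply/eqP; rewrite -subr_eq0; apply/eqP/nrm_eq0/eqP.
  have [v Dv vE] := surj (x - u).
  rewrite -sqrf_eq0 -rdot_nrm -{1}vE (hermitianBr ih) (symk v u)// uE.
  rewrite (hermitianDl ih) (hermitianDr ih) xy//.
  by rewrite (hermitianZl ih) (hermitianZr ih) conj_rC subrr.
by rewrite /op_graph/= xu; split => //; move: uE; rewrite xu => /addIr <-.
Qed.

(** * Inversion of [s A + k] when it is at least 1 *)

Section Inverse.
Variables (A : operator H) (s k : R).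
Hypothesis Asa : selfadjoint A.
Hypothesis s0 : s != 0.
Let B u := s%:C *: A u + k%:C *: u.
Hypothesis B_ge1 : forall u, op_dom A u ->
  nrm u ^+ 2 <= complex.Re (inner (B u) u).

Let BP c u v : op_dom A u -> op_dom A v -> B (c *: u + v) = c *: B u + B v.
Proof.
move=> Du Dv; rewrite /B op_linear// !scalerDr addrACA !scalerA.
by rewrite !(mulrC c).
Qed.

Let B0 : B 0 = 0.
Proof. by rewrite /B op0 !scaler0 addr0. Qed.

Let BB u v : op_dom A u -> op_dom A v -> B (u - v) = B u - B v.
Proof. by move=> Du Dv; rewrite addrC -scaleN1r BP// scaleN1r addrC. Qed.

Let B_sym u v : op_dom A u -> op_dom A v -> inner (B u) v = inner u (B v).
Proof.
move=> Du Dv; rewrite /B !(hermitianDl ih, hermitianDr ih, hermitianZl ih,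
  hermitianZr ih).
by rewrite !conj_rC selfadjoint_symmetric.
Qed.

Let nrm_B u : op_dom A u -> nrm u <= nrm (B u).
Proof.
move=> Du; have := B_ge1 Du; have := rdot_le (B u) u.
rewrite ler_norml => /andP[_ h1] /le_trans /(_ h1).
have [->|u0] := eqVneq (nrm u) 0; first by rewrite nrm_ge0.
by rewrite expr2 ler_pM2r// lt_def u0 nrm_ge0.
Qed.

(** [B] inherits selfadjointness: solved for [A], the identity puts [x] in the domain of the adjoint
    of [A]. *)
Let B_adjoint x y : (forall v, op_dom A v -> inner (B v) x = inner v y) ->
  op_dom A x /\ B x = y.
Proof.
move=> xy; have sC : s%:C != 0 :> R[i].
  by apply: contra s0 => /eqP[->].
have [/= Dx Ax] : op_graph A (x, (s^-1)%:C *: (y - k%:C *: x)).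
  rewrite Asa.2 => v /xy /=; rewrite /B !(hermitianDl ih, hermitianZl ih,
    hermitianZr ih, hermitianBr ih) !conj_rC => <-.
  by rewrite addrK mulrA -rmorphM mulVf// mul1r.
by split => //; rewrite /B -Ax scalerA -rmorphM mulfV// scale1r subrK.
Qed.

(** The range of [B] is closed, since [B] is closed and [nrm u <= nrm (B u)]; a vector orthogonal to
    it lies in the kernel of [B], which is trivial. *)
Lemma selfadjoint_surjective f : exists2 u, op_dom A u & B u = f.
Proof.
pose D := B @` op_dom A.
have Dsub : submodule D.
  split=> [|c _ _ [u Du <-] [v Dv <-]]; first by exists 0 => //; exact: op_dom0.
  by exists (c *: u + v); [exact: op_domP|rewrite BP].
(* [d] is the orthogonal projection of [f] onto the closure of the range of [B]. *)
have [c u v|u|d_ [d [Dd dd df]]] := variational ih ltr01 inner_coercive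
   inner_bounded (l := inner ^~ f) (K := nrm f) Dsub.
- exact: ih.1.
- by rewrite mulrC rdot_le.
have /choice[u_ uP] n : exists u, op_dom A u /\ B u = d_ n.
  by have [u Du <-] := Dd n; exists u.
have [u uu] : exists u, ncvg u_ u.
  apply: (ncauchy_cvg dd) => m n.
  have [[Dm Bm] [Dn Bn]] := (uP m, uP n).
  apply: le_trans (nrm_B (op_domB Dm Dn)) _; rewrite BB// Bm Bn.
  by rewrite (nrm_distC (d_ n)); exact: nrm_dist.
(* Closedness of [B]: the identity [<B v, u_n> = <v, d_n>] passes to the limit, and [B_adjoint]
   applies. *)
have [Du Bu] : op_dom A u /\ B u = d.
  apply: B_adjoint; apply: (eq_Re_linear (op_dom_submodule A)).
  - by move=> c v Dv; rewrite -[c *: v]addr0 (BP c Dv (op_dom0 A)) B0 addr0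
      (hermitianZl ih).
  - by move=> c v _; rewrite (hermitianZl ih).
  move=> v Dv; apply: (cvg_real_unique (cvg_rdotr (v := B v) uu)).
  rewrite (_ : (fun _ => _) = (fun n => complex.Re (inner v (d_ n)))).
    exact: cvg_rdotr.
  by apply/funext => n; have [Dn <-] := uP n; rewrite B_sym.
have [Df Bf] : op_dom A (f - d) /\ B (f - d) = 0.
  apply: B_adjoint => v Dv.
  by rewrite (hermitianBr ih) (hermitian0r ih) df ?subrr//; exists v.
exists u => //; rewrite Bu; apply/eqP; rewrite eq_sym -subr_eq0.
apply/eqP/nrm_eq0/le_anti; rewrite nrm_ge0 andbT.
by rewrite (le_trans (nrm_B Df))// Bf nrm0.
Qed.

(** [T] is the inverse of [B]. With [w = T u], the bound on [u - T u] is [|B w - w|^2 = |B w|^2 - 2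
    Re <B w, w> + |w|^2 <= |B w|^2]; it makes [1 - T] a contraction, as the square root requires. *)
Lemma selfadjoint_resolvent : exists T : H -> H,
  [/\ forall c u v, T (c *: u + v) = c *: T u + T v,
      forall u v, inner (T u) v = inner u (T v),
      forall u, nrm (u - T u) <= nrm u
    & forall u v, op_dom A u /\ B u = v <-> u = T v].
Proof.
have /choice[T TP] f : exists u, op_dom A u /\ B u = f.
  by have [u Du <-] := selfadjoint_surjective f; exists u.
have B_inj u v : op_dom A u -> op_dom A v -> B u = B v -> u = v.
  move=> Du Dv uv; apply/eqP; rewrite -subr_eq0; apply/eqP/nrm_eq0/le_anti.
  rewrite nrm_ge0 andbT (le_trans (nrm_B (op_domB Du Dv)))// BB// uv subrr.
  by rewrite nrm0.
have TE u v : op_dom A u /\ B u = v <-> u = T v.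
  have [DT BT] := TP v; split=> [[Du Bu]|->//].
  by apply: B_inj => //; rewrite Bu BT.
exists T; split=> // [c u v|u v|u].
- have [[Du Bu] [Dv Bv]] := (TP u, TP v).
  by apply/esym/TE; split; [exact: op_domP|rewrite BP// Bu Bv].
- have [[Du Bu] [Dv Bv]] := (TP u, TP v).
  by rewrite -{1}Bv -{2}Bu B_sym.
have [Du Bu] := TP u; rewrite -{1 3}Bu.
rewrite -(@ler_pXn2r _ 2)// ?nnegrE ?nrm_ge0//.
have -> : B (T u) - T u = 1%:C *: B (T u) + (-1)%:C *: T u.
  by rewrite rmorphN1 scale1r scaleN1r.
by rewrite nrm_comb; have := sqr_ge0 (nrm (T u)); have := B_ge1 Du; lra.
Qed.

End Inverse.
End SelfadjointOperators.

(** * Square roots of positive contractions *)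

Section SquareRoot.
Context {R : realType} {H : hilbertType R}.
Implicit Types (u v w : H).
Let ih := @inner_hermitian R H.
Variable S : H -> H.
Hypothesis Slin : forall (c : R[i]) u v, S (c *: u + v) = c *: S u + S v.
Hypothesis Ssym : forall u v, inner (S u) v = inner u (S v).
Hypothesis S_le1 : forall u, nrm (S u) <= nrm u.

Let Y := fix Y (n : nat) : H -> H :=
  if n is m.+1 then fun u => (2^-1)%:C *: (S u + Y m (Y m u)) else fun=> 0.
Let y := fix y (n : nat) : R := if n is m.+1 then (1 + y m ^+ 2) / 2 else 0.

Let YS n u : Y n.+1 u = (2^-1)%:C *: (S u + Y n (Y n u)). Proof. by []. Qed.

Let Ylin n (c : R[i]) u v : Y n (c *: u + v) = c *: Y n u + Y n v.
Proof.
elim: n u v => [|n IH] u v /=; first by rewrite scaler0 addr0.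
by rewrite Slin !IH addrACA -(scalerDr c (S u)) [LHS]scalerDr !scalerA mulrC.
Qed.

Let YB n u v : Y n (u - v) = Y n u - Y n v.
Proof. by rewrite addrC -scaleN1r Ylin scaleN1r addrC. Qed.

Let Ysym n u v : inner (Y n u) v = inner u (Y n v).
Proof.
elim: n u v => [|n IH] u v /=; first by rewrite (hermitian0l ih) (hermitian0r
  ih).
by rewrite (hermitianZl ih) (hermitianZr ih) conj_rC (hermitianDl ih)
  (hermitianDr ih) Ssym !IH.
Qed.

Let y01 n : 0 <= y n <= 1.
Proof.
elim: n => [|n /andP[IH0 IH1]] /=; first by rewrite lexx ler01.
by apply/andP; split; nra.
Qed.

Let y_le n : y n <= y n.+1.
Proof. by have /andP[h0 h1] := y01 n; rewrite /=; nra. Qed.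

Let Y_le n u : nrm (Y n u) <= y n * nrm u.
Proof.
elim: n u => [|n IH] u /=; first by rewrite nrm0 mul0r.
rewrite nrmZ ger0_norm ?invr_ge0//.
have := nrmD (S u) (Y n (Y n u)); have := S_le1 u; have := IH u.
have := IH (Y n u); have /andP[+ _] := y01 n.
move: (nrm (_ + _)) (nrm (S u)) (nrm (Y n u)) (nrm (Y n _)) (nrm u) (y n).
move=> a b c d e z z0 h1 h2 h3 h4; nra.
Qed.

(** The difference of consecutive squares is split as [Y_(n+1) (Y_(n+1) - Y_n) + (Y_(n+1) - Y_n)
    Y_n], which holds without commutation; the scalars [y] satisfy the same identity, so the
    induction closes. *)
Let Y_step n u : nrm (Y n.+1 u - Y n u) <= (y n.+1 - y n) * nrm u.
Proof.
elim: n u => [|n IH] u.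
  rewrite /= !subr0 addr0 expr0n/= addr0 div1r nrmZ ger0_norm ?invr_ge0//.
  by rewrite ler_wpM2l ?invr_ge0.
have -> : Y n.+2 u - Y n.+1 u = (2^-1)%:C *:
   (Y n.+1 (Y n.+1 u - Y n u) + (Y n.+1 (Y n u) - Y n (Y n u))).
  rewrite (YS n.+1 u) {2}(YS n u) YB addrA subrK -scalerBr.
  by rewrite opprD addrACA subrr add0r.
rewrite nrmZ ger0_norm ?invr_ge0//.
have h1 := nrmD (Y n.+1 (Y n.+1 u - Y n u)) (Y n.+1 (Y n u) - Y n (Y n u)).
have h2 := Y_le n.+1 (Y n.+1 u - Y n u).
have h3 := IH (Y n u); have h4 := IH u; have h5 := Y_le n u.
have yE : y n.+2 = (1 + y n.+1 ^+ 2) / 2 by [].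
have yE' : y n.+1 = (1 + y n ^+ 2) / 2 by [].
have /andP[y0 _] := y01 n.+1; have h6 := y_le n.
have h7 := ler_wpM2l y0 h4; have d0 : 0 <= y n.+1 - y n by lra.
have h8 := ler_wpM2l d0 h5.
have -> : (y n.+2 - y n.+1) * nrm u =
  2^-1 * (y n.+1 * ((y n.+1 - y n) * nrm u) + (y n.+1 - y n) * (y n * nrm u)).
  by rewrite yE {2}yE'; field.
rewrite ler_pM2l ?invr_gt0//.
by apply: le_trans h1 _; apply: lerD; [exact: le_trans h7|exact: le_trans h8].
Qed.

Let Y_dist m n u : (m <= n)%N -> nrm (Y n u - Y m u) <= (y n - y m) * nrm u.
Proof.
move=> /subnK <-; elim: (n - m)%N => [|k IH].
  by rewrite add0n !subrr nrm0 mul0r.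
have h1 := nrm_dist (Y (k + m).+1 u) (Y (k + m) u) (Y m u).
have h2 := Y_step (k + m) u.
rewrite addSn; apply: le_trans h1 _; apply: le_trans (lerD h2 IH) _.
by rewrite -mulrDl addrA subrK.
Qed.

(* [1 - sqrt (1 - S)] is the limit of [Y_0 = 0, Y_(n+1) = (S + Y_n^2)/2]; the
   scalar recursion with [S = 1] controls the operator norm of the increments. *)
Lemma sqrt_one_minus_contraction : exists J : H -> H,
  [/\ forall (c : R[i]) u v, J (c *: u + v) = c *: J u + J v,
      forall u v, inner (J u) v = inner u (J v),
      forall u, nrm (J u) <= 2 * nrm u
    & forall u, J (J u) = u - S u].
Proof.
have ymono : nondecreasing_seq y by apply/nondecreasing_seqP.
have ycvg : cvgn y.
  apply: nondecreasing_is_cvgn => //.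
  by exists 1 => _ [n _ <-]; case/andP: (y01 n).
pose l := limn y; have yl : y @ \oo --> l by [].
have ly0 : (fun n => l - y n) @ \oo --> 0.
  by rewrite -(subrr l); apply: cvgB => //; exact: cvg_cst.
have y_l n : y n <= l.
  exact: nondecreasing_cvgn_le.
have /choice[Z ZP] u : exists z, ncvg (Y ^~ u) z.
  apply: (@ncauchy_cvg _ _ _ (fun n => (l - y n) * nrm u)).
    by rewrite -(mul0r (nrm u)); apply: cvgMr_tmp.
  have nu := nrm_ge0 u.
  have aux m n : (m <= n)%N ->
      nrm (Y n u - Y m u) <= (l - y m) * nrm u + (l - y n) * nrm u.
    move=> mn; apply: le_trans (Y_dist u mn) _.
    by rewrite -mulrDl ler_wpM2r//; have := y_l m; have := y_l n; lra.
  move=> m n; have [mn|/ltnW nm] := leqP m n.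
    by rewrite nrm_distC; exact: aux.
  by rewrite [leRHS]addrC; exact: aux.
have Zlin (c : R[i]) u v : Z (c *: u + v) = c *: Z u + Z v.
  apply: (ncvg_unique (ZP _)).
  rewrite (_ : _ ^~ _ = (fun n => c *: Y n u + Y n v)); last first.
    by apply/funext => n; rewrite Ylin.
  by apply: ncvgD => //; exact: ncvgZ.
have ZB u v : Z (u - v) = Z u - Z v.
  by rewrite addrC -scaleN1r Zlin scaleN1r addrC.
have Zsym v : forall u, [set: H] u -> inner (Z u) v = inner u (Z v).
  apply: (eq_Re_linear (submoduleT (V := H))).
  - have Z0 : Z 0 = 0 by have := ZB 0 0; rewrite !subrr.
    by move=> c w _; rewrite -[c *: w]addr0 Zlin Z0 addr0 (hermitianZl ih).
  - by move=> c w _; rewrite (hermitianZl ih).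
  move=> u _; apply: (cvg_real_unique (x := fun n => complex.Re (inner (Y n u)
    v))).
    rewrite (_ : (fun _ => _) = (fun n => complex.Re (inner v (Y n u)))).
      by rewrite (Re_hermitianC ih); exact: cvg_rdotr.
    by apply/funext => n; rewrite (Re_hermitianC ih).
  rewrite (_ : (fun _ => _) = (fun n => complex.Re (inner u (Y n v)))).
    exact: cvg_rdotr.
  by apply/funext => n; rewrite Ysym.
have Y_le1 n u : nrm (Y n u) <= nrm u.
  apply: le_trans (Y_le n u) _.
  by rewrite ler_piMl ?nrm_ge0//; case/andP: (y01 n).
have Z_le u : nrm (Z u) <= nrm u.
  apply: (ler_cvg_to (ncvg_nrm (ZP u)) (cvg_cst (nrm u))).
  by apply: nearW => n; exact: Y_le1.
(* The limit of the recursion; it yields [(1 - Z)^2 = 1 - 2 Z + Z^2 = 1 - S]. That [Y_n (Y_n u)]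
   tends to [Z (Z u)] uses that every [Y n] is a contraction. *)
have ZE u : S u + Z (Z u) = 2%:C *: Z u.
  have h : ncvg (fun n => S u + Y n (Y n u)) (2%:C *: Z u).
    rewrite (_ : (fun _ => _) = (fun n => 2%:C *: Y n.+1 u)).
      apply: ncvgZ; rewrite /ncvg.
      by have := ZP u; rewrite /ncvg -(cvg_shiftS (fun n => nrm (Y n u - Z u))).
    apply/funext => n; rewrite [Y n.+1 u]/= scalerA -rmorphM mulfV ?scale1r//.
    by rewrite pnatr_eq0.
  apply: ncvg_unique h.
  have {}ZP := ZP; apply: (@cvg_dominated _ _
    (fun n => nrm (Y n u - Z u) + nrm (Y n (Z u) - Z (Z u))) _ 1).
    by rewrite -(addr0 0); apply: cvgD; exact: ZP.
  move=> n; rewrite subr0 mul1r ger0_norm ?nrm_ge0//.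
  rewrite opprD addrACA subrr add0r.
  by apply: le_trans (nrm_dist _ (Y n (Z u)) _) _; rewrite lerD2r -YB Y_le1.
exists (fun u => u - Z u); split=> [c u v|u v|u|u].
- by rewrite Zlin scalerBr opprD addrACA.
- by rewrite (hermitianBl ih) (hermitianBr ih) Zsym.
- by apply: le_trans (nrmB _ _) _; rewrite mulr_natl mulr2n lerD2l.
have -> : S u = Z u + Z u - Z (Z u).
  by apply/eqP; rewrite eq_sym subr_eq ZE rmorphD scalerDl scale1r.
by rewrite ZB !opprB -addrA; congr (_ + _); rewrite addrCA opprD.
Qed.

End SquareRoot.

(** * The form of a semibounded selfadjoint operator *)

Section ComplexSequences.
Context {R : realType}.

Lemma cvg_sqr0 (x : nat -> R) :
  (fun n => x n ^+ 2) @ \oo --> 0 -> x @ \oo --> 0.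
Proof.
move=> /cvgrPdist_lt x0; apply/cvgrPdist_lt => e e0.
have := x0 (e ^+ 2); rewrite exprn_gt0// => /(_ isT); apply: filterS => n.
by rewrite !sub0r !normrN normrX ltr_pXn2r// nnegrE// ltW.
Qed.

Lemma cvg_complex0 (z : nat -> R[i]) :
  (z n : R[i]^o) @[n --> \oo] --> (0 : R[i]^o) <->
  (fun n => complex.Re `|z n|) @ \oo --> (0 : R).
Proof.
rewrite -(@ncvgP _ R[i]^o) /ncvg /nrm.
by rewrite (_ : (fun n => complex.Re `|z n - 0|) =
  fun n => complex.Re `|z n|)//; apply/funext => n; rewrite subr0.
Qed.

End ComplexSequences.

(** * Bounded Hermitian forms as continuous sesquilinear forms *)

Section FormConstruction.
Context {R : realType}.

(** Evaluating at ['i *: u] turns the bound on real parts into one on imaginary parts; adding the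
    two gives the factor 2. *)
Lemma normc_hermitian (V : normedModType R[i]) (b : V -> V -> R[i]) (M : R) :
  hermitian_form b ->
  (forall u v, `|complex.Re (b u v)| <= M * (nrm u * nrm v)) ->
  forall u v, complex.Re `|b u v| <= 2 * M * (nrm u * nrm v).
Proof.
move=> bh bM u v; apply: le_trans (normc_le _) _.
have := bM ('i *: u) v; rewrite (Re_hermitianZi bh) normrN nrmZc.
have -> : complex.Re `|'i : R[i]| = 1.
  by rewrite normc_def /= expr0n expr1n add0r sqrtr1.
by rewrite mul1r; have := bM u v; lra.
Qed.

Section Sesquilinear.
Variables (V : lmodType R[i]) (b : V -> V -> R[i]).
Hypothesis bh : hermitian_form b.

Let b_zmodl v : zmod_morphism (b ^~ v).
Proof. by move=> u w; rewrite (hermitianBl bh). Qed.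

Let b_zmodr u : zmod_morphism (b u).
Proof. by move=> v w; rewrite (hermitianBr bh). Qed.

Let b_scall v : scalable_for *%R (b ^~ v).
Proof. by move=> c u; rewrite (hermitianZl bh). Qed.

Let b_scalr u : scalable_for (@Num.conj R[i] \; *%R) (b u).
Proof. by move=> c v; rewrite (hermitianZr bh). Qed.

Definition sesquilinear_of_hermitian : {sesquilinear V} :=
  HB.pack b (isBilinear.Build _ _ _ _ _ _ b b_zmodl b_zmodr b_scall b_scalr).

End Sesquilinear.

Lemma continuous_sesquilinear_of_bounded (V : hilbertType R)
    (a : {sesquilinear V}) (M : R) : hermitian_form a ->
  (forall u v, `|complex.Re (a u v)| <= M * (nrm u * nrm v)) ->
  continuous_sesquilinear a.
Proof.
move=> ah /(normc_hermitian ah) aM [u v].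
apply/cvgrPdist_lt => _ /gtc0_real[e e0 ->].
(* Since [d <= 1], the norm of [v'] is at most [nrm v + 1], so the two terms of the increment add up
   to less than [d C <= e]. The last [+ 1] keeps [C] positive and the estimate strict. *)
pose C := `|2 * M| * (nrm u + nrm v + 1) + 1.
have C0 : 0 < C by rewrite ltr_wpDl// mulr_ge0// !addr_ge0 ?nrm_ge0.
pose d := Num.min 1 (e / C).
have d0 : 0 < d by rewrite lt_min ltr01 divr_gt0.
exists (ball u d%:C, ball v d%:C).
  by split; apply: nbhsx_ballx; rewrite ltcR.
move=> [u' v'] [/=]; rewrite -!ball_normE /ball_/= !nrm_ltC => du dv.
have -> : a u v - a u' v' = a (u - u') v' + a u (v - v').
  by rewrite (hermitianBl ah) (hermitianBr ah) [RHS]addrC addrA subrK.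
apply: le_lt_trans (nrmD (V := R[i]^o) _ _) _.
apply: le_lt_trans (lerD (aM _ _) (aM _ _)) _.
have v'v : nrm v' <= nrm v + d.
  by have := nrm_dist v' v 0; rewrite !subr0 nrm_distC; lra.
have d1 : d <= 1 by rewrite ge_min lexx.
have dC : d * C <= e.
  by rewrite -ler_pdivlMr// ge_min lexx orbT.
apply: lt_le_trans dC; rewrite /C.
have := nrm_ge0 u; have := nrm_ge0 v; have := nrm_ge0 v'.
have := nrm_ge0 (u - u'); have := nrm_ge0 (v - v').
have := normr_ge0 (2 * M); have := ler_norm (2 * M).
move: du dv v'v.
move: (nrm (u - _)) (nrm (v - _)) (nrm u) (nrm v) (nrm v') (2 * M).
move=> x y p q r m; move: `|m| => n xd yd rq mn n0 y0 x0 r0 q0 p0.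
have h1 : x * r <= d * (q + 1) by apply: ler_pM; lra.
have h2 : p * y <= p * d by rewrite ler_wpM2l// ltW.
have h3 : 0 <= x * r + p * y by rewrite addr_ge0// mulr_ge0.
have h4 := ler_wpM2r h3 mn.
have h5 := ler_wpM2l n0 (lerD h1 h2).
by rewrite -mulrDr; apply: le_lt_trans h4 _; apply: le_lt_trans h5 _; lra.
Qed.

(** * The form carried by the square root of the inverse *)

Section FormOfSelfadjoint.
Variables (H : hilbertType R) (A : operator H) (s k : R).
Hypothesis Asa : selfadjoint A.
Hypothesis ss : s * s = 1.
Hypothesis B_ge1 : forall u, op_dom A u ->
  nrm u ^+ 2 <= complex.Re (inner (s%:C *: A u + k%:C *: u) u).
Let ih := @inner_hermitian R H.

Let s0 : s != 0.
Proof. by apply/eqP => s0; move: ss; rewrite s0 mul0r => /esym/eqP;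
  rewrite oner_eq0. Qed.

Let sZ (u : H) : s%:C *: (s%:C *: u) = u.
Proof. by rewrite scalerA -rmorphM ss scale1r. Qed.

(* With [T] the inverse of [s A + k] and [J] its square root, the form domain
   is the range of [J] with the norm transported from [H] itself. *)
Lemma exists_form : exists (V : hilbertType R) (j : {linear V -> H})
  (a : {sesquilinear V}), form_of_operator A j a.
Proof.
have [T [Tlin Tsym Tle TP]] := selfadjoint_resolvent Asa s0 B_ge1.
(* The root is taken for the contraction [S = 1 - T], so that [J J = 1 - S = T]. *)
have [|||J [Jlin Jsym Jle JJ]] := @sqrt_one_minus_contraction R H
  (fun u => u - T u).
- by move=> c u v; rewrite Tlin scalerBr opprD addrACA.
- by move=> u v; rewrite (hermitianBl ih) (hermitianBr ih) Tsym.
- exact: Tle.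
have {}JJ u : J (J u) = T u by rewrite JJ opprB addrC subrK.
pose j : {linear H -> H} := HB.pack J (GRing.isLinear.Build _ _ _ _ J Jlin).
(* As [J] acts as [(s A + k)^(-1/2)], the product [<u, v>] is the form of [s A + k] at [J u], [J v];
   removing [k] and multiplying by [s] leaves the form of [A]. *)
pose b u v := s%:C * (inner u v - k%:C * inner (J u) (J v)).
have bh : hermitian_form b.
  split=> [c u v w|u v].
    by rewrite /b Jlin !ih.1; ring.
  rewrite /b rmorphM rmorphB rmorphM /= !conj_rC.
  by rewrite -!ih.2.
pose a := sesquilinear_of_hermitian bh.
exists H, j, a; split.
- split.
  + move=> u v /(congr1 J); rewrite /j/= !JJ => uv.
    have [_ <-] := (TP (T u) u).2 erefl.
    by have [_ <-] := (TP (T v) v).2 erefl; rewrite uv.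
  + exact: (@bounded_continuous R H H j 2).
  (* The range of [J] contains that of [J J = T], which is the dense domain of [A]. *)
  + move=> O O0 Oo; have [x [Ox Dx]] := Asa.1 _ O0 Oo.
    exists x; split => //; have := (TP x _).1 (conj Dx erefl).
    by rewrite -JJ => ->; eexists.
- by move=> u v; exact: bh.2.
- apply: (continuous_sesquilinear_of_bounded (M := `|s| * (1 + `|k| * 4))) =>
    // u v.
  rewrite /= /b ReZ ReD ReN ReZ normrM -mulrA ler_wpM2l//.
  rewrite (le_trans (ler_normB _ _))// mulrDl lerD ?mul1r ?rdot_le//.
  rewrite normrM -mulrA ler_wpM2l// (le_trans (rdot_le _ _))//.
  apply: le_trans (ler_pM (nrm_ge0 _) (nrm_ge0 _) (Jle u) (Jle v)) _.
  by rewrite mulrACA -natrM.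
(* This shift cancels the [J] term, leaving [s |u|^2] on the diagonal. *)
- exists (- (s * k)%:C) => u _ bu.
  apply/cvg_complex0.
  have -> : (fun n => complex.Re `| `|u n| |) = nrm \o u.
    by apply/funext => n; rewrite normr_id.
  have s1 : `|s| = 1.
    by apply/eqP; rewrite -sqrp_eq1 ?normr_ge0// -normrX expr2 ss normr1.
  apply: cvg_sqr0; move/cvg_complex0 : bu.
  rewrite (_ : (fun n => complex.Re `|shifted_form j a _ (u n) (u n)|) =
    (fun n => (nrm \o u) n ^+ 2))//; apply/funext => n.
  have -> : shifted_form j a (- (s * k)%:C) (u n) (u n) =
      (s * nrm (u n) ^+ 2)%:C.
    rewrite /shifted_form/= /b rmorphM mulNr opprK mulrBr -!mulrA subrK
      inner_norm.
    by rewrite nrmE -rmorphXn -rmorphM.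
  rewrite normc_def /= expr0n addr0 sqrtr_sqr normrM s1 mul1r.
  by rewrite ger0_norm// sqr_ge0.
- apply/seteqP; split=> [[x f] [/= Dx ->]|[x f] [/= u -> uP]].
    set g := s%:C *: A x + k%:C *: x.
    have xg := (TP x g).1 (conj Dx erefl).
    exists (J g); first by rewrite /= JJ.
    move=> v; rewrite /= /b Jsym JJ -xg -(hermitianZl ih) -(hermitianBl ih).
    by rewrite addrK -(hermitianZl ih) sZ.
  (* The identity for the form multiplied by [s], with [J] moved across the inner product. Applying
     [J] once more writes [J u] as a value of [T]. *)
  have ug : u = J (s%:C *: f + k%:C *: J u).
    apply/eqP; rewrite -subr_eq0; apply/eqP/inner_eq0 => v.
    rewrite (hermitianBl ih) Jsym (hermitianDl ih) !(hermitianZl ih) -uP /= /b.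
    by rewrite mulrA -rmorphM ss mul1r subrK subrr.
  have := congr1 J ug; rewrite JJ => /TP[Dx Bx].
  split => //=; move/addIr: Bx => /(congr1 ( *:%R s%:C)).
  by rewrite !sZ.
Qed.

End FormOfSelfadjoint.

Lemma form_of_selfadjoint (H : hilbertType R) (A : operator H) :
  selfadjoint A -> semibounded A ->
  exists (V : hilbertType R) (j : {linear V -> H}) (a : {sesquilinear V}),
    form_of_operator A j a.
Proof.
have ih := @inner_hermitian R H.
have ReA (c : R) u : complex.Re (c%:C * `|u : H| ^+ 2) = c * nrm u ^+ 2.
  by rewrite ReZ nrmE -rmorphXn.
move=> Asa [[c cA]|[c cA]].
  (* The shifts [1 - c] and [1 + c] turn the given bound into [s A + k >= 1], with [s = -1] for an
     upper bound. *)
  apply: (@exists_form H A 1 (1 - c)) => //; first exact: mulr1.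
  move=> u /cA; rewrite lecE ReA => /andP[_ cu].
  by rewrite scale1r (hermitianDl ih) (hermitianZl ih) ReD ReZ rdot_nrm; lra.
apply: (@exists_form H A (-1) (1 + c)) => //; first by rewrite mulrNN mulr1.
move=> u /cA; rewrite lecE ReA => /andP[_ cu].
by rewrite (hermitianDl ih) !(hermitianZl ih) ReD !ReZ rdot_nrm; lra.
Qed.

End FormConstruction.

(** * The operator of an essentially coercive form *)

Section BoundedForms.
Context {R : realType}.

(** Continuity at [(0, 0)] gives radii [d], [e] within which the form is below 1; rescaling [u] and
    [v] to norms [d / 2] and [e / 2] gives [4 / (d e)]. *)
Lemma continuous_sesquilinear_bounded (V : hilbertType R)
    (a : {sesquilinear V}) :
  hermitian_form a -> continuous_sesquilinear a ->
  exists2 M : R, 0 < M &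
    forall u v, `|complex.Re (a u v)| <= M * (nrm u * nrm v).
Proof.
move=> ah ca; have lt01 : 0 < (1 : R)%:C by rewrite ltcR.
have /cvgrPdist_lt/(_ _ lt01)[[P Q]] := ca (0, 0).
rewrite /= (hermitian0l ah) => -[/nbhs_norm0P[/= _ /gtc0_real[d d0 ->] dP]].
move=> /nbhs_norm0P[/= _ /gtc0_real[e e0 ->] eQ] PQ; clear lt01.
exists (4 / (d * e)) => [|u v]; first by rewrite divr_gt0// mulr_gt0.
have [->|u0] := eqVneq u 0.
  by rewrite (hermitian0l ah) normr0 nrm0 mul0r mulr0.
have [->|v0] := eqVneq v 0.
  by rewrite (hermitian0r ah) normr0 nrm0 !mulr0.
have [nu nv] := (nrm_gt0 u0, nrm_gt0 v0).
pose x := d / (2 * nrm u); pose y := e / (2 * nrm v).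
have x0 : 0 < x by rewrite divr_gt0// mulr_gt0.
have y0 : 0 < y by rewrite divr_gt0// mulr_gt0.
have Pu : P (x%:C *: u).
  apply: dP => /=; rewrite nrm_ltC nrmZ gtr0_norm//.
  have -> : x * nrm u = d / 2 by rewrite /x; field; rewrite gt_eqF.
  by clear -d0; lra.
have Qv : Q (y%:C *: v).
  apply: eQ => /=; rewrite nrm_ltC nrmZ gtr0_norm//.
  have -> : y * nrm v = e / 2 by rewrite /y; field; rewrite gt_eqF.
  by clear -e0; lra.
have /= := PQ (x%:C *: u, y%:C *: v) (conj Pu Qv).
rewrite sub0r normrN (hermitianZl ah) (hermitianZr ah) conj_rC.
rewrite (@nrm_ltC R R[i]^o) => /(le_lt_trans (normc_ge_Re _)).
rewrite !ReZ (normrM x) (normrM y) (gtr0_norm x0) (gtr0_norm y0) => /ltW.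
rewrite mulrA => h; rewrite -(ler_pM2l (mulr_gt0 x0 y0)).
apply: le_trans h _.
rewrite le_eqVlt; apply/orP; left; apply/eqP; rewrite /x /y; field.
by rewrite !gt_eqF.
Qed.

Lemma continuous_scalar_bounded (V : normedModType R[i]) (f : {scalar V}) :
  continuous (f : V -> R[i]^o) ->
  exists2 K : R, 0 < K & forall u, complex.Re `|f u| <= K * nrm u.
Proof.
move=> cf; have flin : GRing.linear_for *:%R (f : V -> R[i]^o).
  by move=> c u v; exact: linearP.
pose g : {linear V -> R[i]^o} :=
  HB.pack (f : V -> R[i]^o) (GRing.isLinear.Build _ _ _ _ (f : V -> R[i]^o)
    flin).
exact: (@continuous_bounded R V R[i]^o g cf).
Qed.

(* The adjoint of [j] has dense range because [j] is injective, so it suffices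
   to test the bounded sequence [u_] against this range. *)
Lemma weak_cvg0_embedding (V H : hilbertType R) (j : {linear V -> H})
    (u_ : nat -> V) (C : R) : continuous_dense_embedding j ->
  (forall n, nrm (u_ n) <= C) -> ncvg (j \o u_) 0 -> weak_cvg0 u_.
Proof.
move=> [jinj jcont _] uC ju f /continuous_scalar_bounded[K K0 fK].
have [iV iH] := (@inner_hermitian R V, @inner_hermitian R H).
have [L L0 jL] := continuous_bounded jcont.
have [c u v|u|d fd] := riesz (l := f) (K := K).
- exact: linearP.
- exact: le_trans (normc_ge_Re _) (fK u).
(* The Riesz vector [d] of [f] is approximated by values of the adjoint of [j]. A [w] orthogonal to
   them all satisfies [<j w, x> = 0] for every [x], so [j w = 0]. *)
have [D_ DD Dd] : exists2 d_ : nat -> V,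
    forall n, exists x, forall v, inner (j v) x = inner v (d_ n) & ncvg d_ d.
  have/dense_approx : dense [set w : V | exists x, forall v, inner (j v) x =
    inner v w].
    apply: dense_of_orthogonal0.
      split; first by exists 0 => v; rewrite (hermitian0r iV) (hermitian0r iH).
      move=> c w w' [x xP] [x' xP']; exists (c *: x + x') => v.
      by rewrite (hermitianDr iV) (hermitianDr iH) (hermitianZr iV)
        (hermitianZr iH) xP xP'.
    move=> w w0; apply: jinj; rewrite linear0; apply: inner_eq0 => x.
    have [c u v|u|z zP] := riesz (l := fun v => inner (j v) x) (K := nrm x * L).
    - by rewrite linearP iH.1.
    - apply: le_trans (rdot_le _ _) _; rewrite mulrC -mulrA.
      by rewrite ler_wpM2l ?nrm_ge0.
    by rewrite zP iV.2 w0 ?rmorph0//; exists x.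
  by move=> /(_ d)[d_ Dd dd]; exists d_.
apply/cvg_complex0/cvgrPdist_lt => e e0.
have C0 : 0 <= C by apply: le_trans (uC 0%N); exact: nrm_ge0.
(* [<u_n, d>] splits into [<j u_n, x>] and [<u_n, d - D_ N>]. With the factor 2 of
   [normc_hermitian], [e2] and [e1] keep each part below [e / 2]; the [+ 1] covers [x = 0] and
   [C = 0]. *)
pose e1 := e / (4 * (C + 1)).
have e10 : 0 < e1 by rewrite divr_gt0// mulr_gt0// ltr_wpDl.
move/cvgrPdist_lt : Dd => /(_ _ e10)[N _ /(_ N (leqnn N)) /=].
rewrite sub0r normrN ger0_norm ?nrm_ge0// nrm_distC => de.
have [x xP] := DD N.
pose e2 := e / (4 * (nrm x + 1)).
have e20 : 0 < e2 by rewrite divr_gt0// mulr_gt0// ltr_wpDl// nrm_ge0.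
move/cvgrPdist_lt : ju => /(_ _ e20); apply: filterS => n /=.
rewrite subr0 !sub0r !normrN !ger0_norm ?nrm_ge0//; last first.
  exact: (@nrm_ge0 R R[i]^o).
move=> jue; rewrite fd.
have -> : inner (u_ n) d = inner (j (u_ n)) x + inner (u_ n) (d - D_ N).
  by rewrite xP (hermitianBr iV) addrC subrK.
apply: le_lt_trans (nrmD (V := R[i]^o) _ _) _.
have h1 := normc_hermitian iH inner_bounded (j (u_ n)) x.
have h2 := normc_hermitian iV inner_bounded (u_ n) (d - D_ N).
apply: le_lt_trans (lerD h1 h2) _.
have h3 : nrm (j (u_ n)) * nrm x <= e2 * nrm x.
  by rewrite ler_wpM2r ?nrm_ge0// ltW.
have h4 : nrm (u_ n) * nrm (d - D_ N) <= C * e1.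
  by rewrite ler_pM ?nrm_ge0// ltW.
have h5 : e2 * (4 * (nrm x + 1)) = e.
  by rewrite /e2 divfK// gt_eqF// mulr_gt0// ltr_wpDl// nrm_ge0.
have h6 : e1 * (4 * (C + 1)) = e by rewrite /e1 divfK// gt_eqF// mulr_gt0//
  ltr_wpDl.
lra.
Qed.

End BoundedForms.

(** * Semicoercivity, and the operator read off the form *)

Section FormOfOperator.
Context {R : realType} {H : hilbertType R}.
Variables (A : operator H) (V : hilbertType R) (j : {linear V -> H}).
Variable a : {sesquilinear V}.
Hypothesis Aa : form_of_operator A j a.
Implicit Types u v w : V.
Let iH := @inner_hermitian R H.
Local Notation ra u v := (complex.Re (a u v)).

Lemma form_hermitian : hermitian_form a.
Proof. by split=> [c u v w|u v]; [rewrite linearPl|case: Aa]. Qed.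
Let ah := form_hermitian.

Lemma form_bounded :
  exists2 M : R, 0 < M & forall u v, `|ra u v| <= M * (nrm u * nrm v).
Proof. by case: Aa => _ _ /(continuous_sesquilinear_bounded ah). Qed.

Lemma embedding_bounded : exists2 K : R, 0 < K &
  forall u, nrm (j u) <= K * nrm u.
Proof. by case: Aa => -[_ /continuous_bounded]. Qed.

Lemma embedding_injective : injective j.
Proof. by case: Aa => -[]. Qed.

(** The sequence is weakly null by [weak_cvg0_embedding], and the shift [lambda |j u_n|^2] tends to
    0, so essential coercivity can be used on [a] itself, whatever [lambda] is. *)
Lemma essentially_coercive_small (u_ : nat -> V) (C : R) :
  (forall n, nrm (u_ n) <= C) -> ncvg (j \o u_) 0 ->
  (fun n => ra (u_ n) (u_ n)) @ \oo --> 0 -> (nrm \o u_) @ \oo --> 0.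
Proof.
move=> uC ju au; case: Aa => jde _ _ [lambda coer] _.
have /coer coer' : weak_cvg0 u_ by exact: weak_cvg0_embedding uC ju.
have /cvg_complex0 : (`|u_ n| : R[i]^o) @[n --> \oo] --> (0 : R[i]^o).
  apply: coer'; apply/cvg_complex0.
  have ju2 : (fun n => nrm (j (u_ n)) ^+ 2) @ \oo --> 0.
    have {}ju : (fun n => nrm (j (u_ n))) @ \oo --> 0.
      by move: ju; rewrite /ncvg/=; under eq_fun do rewrite subr0.
    by rewrite -(mulr0 0); under eq_fun do rewrite expr2; exact: cvgM.
  apply: (cvg_dominated (K := 1) (y := fun n =>
    `|ra (u_ n) (u_ n)| + complex.Re `|lambda| * nrm (j (u_ n)) ^+ 2)).
    rewrite -(addr0 0); apply: cvgD; first by rewrite -(normr0 R);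
      exact: cvg_norm.
    by rewrite -(mulr0 (complex.Re `|lambda|)); exact: cvgMl_tmp.
  move=> n; rewrite subr0 mul1r ger0_norm; last exact: (@nrm_ge0 R R[i]^o).
  rewrite /shifted_form; apply: le_trans (nrmB (V := R[i]^o) _ _) _.
  apply: lerD.
    by rewrite (hermitian_diag ah) /nrm normc_def/= expr0n addr0 sqrtr_sqr.
  rewrite inner_norm nrmE -rmorphXn /nrm normrM.
  rewrite [X in `|lambda| * X]normc_def /= expr0n addr0 sqrtr_sqr.
  by rewrite mulr0 subr0 ger0_norm ?sqr_ge0.
by under eq_fun do rewrite normr_id.
Qed.

(* If neither [a] nor [-a] were bounded below by the [V]-norm modulo the
   [H]-norm, there would be unit vectors [u], [v], small in [H], with
   [a u u <= eps] and [- a v v <= eps]; up to a sign change of [v], some [w] in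
   the segment from [u] to [v] is of norm at least [1/2] and [|a w w| <= eps]. *)
Lemma form_semicoercive : exists s omega alpha : R,
  [/\ s = 1 \/ s = -1, 0 < alpha
    & forall u, alpha * nrm u ^+ 2 <= s * ra u u + omega * nrm (j u) ^+ 2].
Proof.
apply: contrapT => nex.
have [M M0 aM] := form_bounded.
(* Semicoercivity fails for [omega = n+1] and [alpha = 1/(n+1)]; normalize the offending vector. As
   [|a(u,u)| <= M] on unit vectors, [(n+1) |j u|^2 <= 1 + M]. *)
have unit n (s : R) : s = 1 \/ s = -1 -> exists u,
    [/\ nrm u = 1, s * ra u u < n.+1%:R^-1
      & nrm (j u) ^+ 2 <= (1 + M) / n.+1%:R].
  move=> sP; have n0 : 0 < n.+1%:R^-1 :> R by rewrite invr_gt0.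
  have n1 : n.+1%:R^-1 <= 1 :> R by rewrite invf_le1// ler1n.
  have [u] : exists u,
      ~ (n.+1%:R^-1 * nrm u ^+ 2 <= s * ra u u + n.+1%:R * nrm (j u) ^+ 2).
    by apply: contrapT => /forallNP h; apply: nex;
      exists s, n.+1%:R, n.+1%:R^-1; split => // u; exact: contrapT.
  move=> /negP; rewrite -ltNge => hu.
  have u0 : 0 < nrm u.
    rewrite lt_def nrm_ge0 andbT; apply/eqP => /nrm_eq0 u0.
    move: hu; rewrite u0 (hermitian0l ah) nrm0 expr0n/= !mulr0 add0r.
    by rewrite ltNge mulr_ge0// sqr_ge0.
  pose u1 := ((nrm u)^-1)%:C *: u.
  have nu1 : nrm u1 = 1 by rewrite nrmZ gtr0_norm ?invr_gt0// mulVf// gt_eqF.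
  have h : s * ra u1 u1 + n.+1%:R * nrm (j u1) ^+ 2 < n.+1%:R^-1.
    rewrite /u1 (hermitianZl ah) (hermitianZr ah) linearZ nrmZ conj_rC !ReZ.
    rewrite gtr0_norm ?invr_gt0//.
    have -> : s * ((nrm u)^-1 * ((nrm u)^-1 * ra u u)) +
      n.+1%:R * ((nrm u)^-1 * nrm (j u)) ^+ 2 =
      (s * ra u u + n.+1%:R * nrm (j u) ^+ 2) / nrm u ^+ 2.
      by field; rewrite gt_eqF.
    by rewrite ltr_pdivrMr// exprn_gt0.
  exists u1; split => //.
    by apply: le_lt_trans h; rewrite lerDl mulr_ge0// sqr_ge0.
  rewrite ler_pdivlMr// mulrC.
  have := aM u1 u1; rewrite nu1 !mulr1 ler_norml.
  move: h n1; clear -sP; move: (n.+1%:R * _) (n.+1%:R^-1) (ra _ _) => x y z.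
  by case: sP => -> h1 h2 /andP[h3 h4]; lra.
have /choice[w_ wP] n : exists w, [/\ 1 / 2 <= nrm w <= 1,
    `|ra w w| <= n.+1%:R^-1 & nrm (j w) ^+ 2 <= (1 + M) / n.+1%:R].
  have [u [nu au ju]] := unit n 1 (or_introl erefl).
  have [v [nv av jv uv]] : exists v, [/\ nrm v = 1, -1 * ra v v < n.+1%:R^-1,
    nrm (j v) ^+ 2 <= (1 + M) / n.+1%:R & 0 <= complex.Re (inner u v)].
    have [v [nv av jv]] := unit n (-1) (or_intror erefl).
    (* A nonnegative real inner product keeps the segment away from 0: the squared norm on it is at
       least [t^2 + (1-t)^2 >= 1/2]. *)
    have [uv|/ltW uv] := leP 0 (complex.Re (inner u v)); first by exists v.
    exists (- v); rewrite (hermitianNl ah) !(hermitianNr ah) opprK (hermitianNr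
      (@inner_hermitian R V)).
    by rewrite linearN !nrmN ReN oppr_ge0.
  have e0 : 0 <= n.+1%:R^-1 :> R by rewrite invr_ge0.
  pose f (t : R) := t ^+ 2 * ra u u + 2 * t * (1 - t) * ra u v +
    (1 - t) ^+ 2 * ra v v.
  (* [f t] is [a w w] at [w = t u + (1-t) v]. Either an endpoint already has a small value, or [f]
     is positive at 0 and negative at 1 and vanishes in between. *)
  have [t /andP[t0 t1] ft] : exists2 t, 0 <= t <= 1 & `|f t| <= n.+1%:R^-1.
    have [au'|au'] := leP (- n.+1%:R^-1) (ra u u).
      exists 1; rewrite ?ler01 ?lexx// /f ler_norml.
      by move: au au' e0; clear; move: (n.+1%:R^-1) => *; apply/andP; split;
        lra.
    have [av'|av'] := leP (ra v v) n.+1%:R^-1.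
      exists 0; rewrite ?ler01 ?lexx// /f ler_norml.
      by move: av av' e0; clear; move: (n.+1%:R^-1) => *; apply/andP; split;
        lra.
    (* The sign is reversed because the intermediate value theorem wants a value at most 0 at the
       left end. *)
    pose p : {poly R} := - ((ra u u) *: 'X^2 + (2 * ra u v) *: ('X * (1 - 'X)) +
      ra v v *: (1 - 'X) ^+ 2).
    have pE x : p.[x] = - f x.
      by rewrite /p /f !hornerE /=; ring.
    have [|t t01 /rootP] := @Num.poly_ivt R p 0 1 ler01.
      by rewrite !pE /f; move: au' av' e0; clear; move: (n.+1%:R^-1) => *;
        apply/andP; split; lra.
    by move/eqP; rewrite pE oppr_eq0 => /eqP ft; exists t; rewrite ?ft ?normr0.
  exists (t%:C *: u + (1 - t)%:C *: v).
  rewrite (Re_hermitian_comb ah); split => //; last first.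
    have jn : nrm (j (t%:C *: u + (1 - t)%:C *: v)) <=
        t * nrm (j u) + (1 - t) * nrm (j v).
      rewrite linearP linearZ; apply: le_trans (nrmD _ _) _.
      by rewrite !nrmZ (ger0_norm t0) (@ger0_norm _ (1 - t)) ?subr_ge0 ?lexx.
    rewrite -(@ler_pXn2r _ 2) ?nnegrE// in jn.
    + apply: le_trans jn _; move: ju jv t0 t1; clear.
      move: (nrm (j u)) (nrm (j v)) ((1 + M) / _) => x y c xc yc t0 t1.
      have h : 0 <= t * (1 - t) * (x - y) ^+ 2.
        by rewrite mulr_ge0 ?sqr_ge0// mulr_ge0 ?subr_ge0.
      have h1 : t * x ^+ 2 <= t * c by rewrite ler_wpM2l.
      have h2 : (1 - t) * y ^+ 2 <= (1 - t) * c by rewrite ler_wpM2l ?subr_ge0.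
      lra.
    + exact: nrm_ge0.
    + by rewrite addr_ge0// mulr_ge0 ?nrm_ge0 ?subr_ge0.
  apply/andP; split.
    have := nrm_comb t (1 - t) u v; rewrite nu nv.
    have h : 0 <= t * (1 - t) * complex.Re (inner u v).
      by rewrite !mulr_ge0 ?subr_ge0.
    move: h t0 t1 (nrm_ge0 (t%:C *: u + (1 - t)%:C *: v)); clear.
    move: (nrm _) (complex.Re _) => x r h t0 t1 x0 xE.
    rewrite -(@ler_pXn2r _ 2) ?nnegrE ?divr_ge0// xE.
    have := sqr_ge0 (t - 1 / 2); lra.
  apply: le_trans (nrmD _ _) _.
  by rewrite !nrmZ nu nv (ger0_norm t0) (@ger0_norm _ (1 - t)) ?subr_ge0//
    !mulr1 addrC subrK.
have w0 : (nrm \o w_) @ \oo --> 0.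
  apply: (essentially_coercive_small (C := 1)).
  - by move=> n; case: (wP n) => /andP[].
  - rewrite /ncvg/=; apply: cvg_sqr0.
    apply: (cvg_dominated (K := 1) (cvg_divSn (1 + M))) => n.
    by rewrite mul1r !subr0 ger0_norm ?sqr_ge0//; case: (wP n).
  - apply: (cvg_dominated (K := 1) cvg_harmonic) => n.
    by rewrite mul1r subr0; case: (wP n).
have : 1 / 2 <= 0 :> R.
  by apply: cvg_le0_cst w0 _ => n; case: (wP n) => /andP[].
by rewrite leNgt divr_gt0.
Qed.

Lemma op_domE x : op_dom A x ->
  exists2 u, x = j u & forall v, a u v = inner (A x) (j v).
Proof.
move=> Dx; case: Aa => _ _ _ _ gA.
have : op_graph A (x, A x) by [].
by rewrite gA => -[u /= xu au]; exists u.
Qed.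

Lemma op_of_form u f : (forall v, a u v = inner f (j v)) ->
  op_dom A (j u) /\ A (j u) = f.
Proof.
move=> au; case: Aa => _ _ _ _ gA.
have : form_graph j a (j u, f) by exists u.
by rewrite -gA => -[/= ? ->].
Qed.

Lemma op_form u v : op_dom A (j u) -> a u v = inner (A (j u)) (j v).
Proof. by move=> /op_domE[u' /embedding_injective ->]. Qed.

(** * Selfadjointness and the form core by Lax-Milgram *)

Section Resolvent.
Variables (s omega alpha : R).
Hypothesis sP : s = 1 \/ s = -1.
Hypothesis alpha0 : 0 < alpha.
Hypothesis a_coercive : forall u,
  alpha * nrm u ^+ 2 <= s * ra u u + omega * nrm (j u) ^+ 2.

Let b u v := s%:C * a u v + omega%:C * inner (j u) (j v).

Let ss : s * s = 1.
Proof. by case: sP => ->; rewrite ?mulrNN mulr1. Qed.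

Let bh : hermitian_form b.
Proof.
split=> [c u v w|u v]; first by rewrite /b linearP !(ah.1, iH.1); ring.
by rewrite /b rmorphD !rmorphM /= !conj_rC -!ah.2 -iH.2.
Qed.

Let b_coercive u : alpha * nrm u ^+ 2 <= complex.Re (b u u).
Proof. by rewrite /b ReD !ReZ rdot_nrm. Qed.

Let b_bounded : exists M, forall u v,
  `|complex.Re (b u v)| <= M * (nrm u * nrm v).
Proof.
have [M M0 aM] := form_bounded; have [K K0 jK] := embedding_bounded.
exists (M + `|omega| * (K * K)) => u v.
rewrite /b ReD !ReZ; apply: le_trans (ler_normD _ _) _; rewrite !normrM mulrDl.
apply: lerD.
  have -> : `|s| = 1 by case: sP => ->; rewrite ?normrN normr1.
  by rewrite mul1r.
rewrite -mulrA ler_wpM2l// (le_trans (rdot_le _ _))// mulrACA.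
by rewrite ler_pM ?nrm_ge0.
Qed.

Let b_represents f : exists w, forall v, b v w = inner (j v) f.
Proof.
have [M bM] := b_bounded; have [K K0 jK] := embedding_bounded.
apply: (lax_milgram bh alpha0 b_coercive bM (l := fun v => inner (j v) f)
  (K := K * nrm f)).
- by move=> c u v; rewrite linearP iH.1.
- move=> u; apply: le_trans (rdot_le _ _) _; rewrite mulrAC.
  by rewrite ler_wpM2r ?nrm_ge0.
Qed.

(** Let [w] be [b]-orthogonal to the domain. For any [f] the solution [u] of [b(., u) = <j ., f>]
    lies in the domain, so [<j w, f> = b(w, u) = 0] and [w = 0]. *)
Lemma form_domain_approx v : exists2 d_ : nat -> V,
  (forall n, op_dom A (j (d_ n))) & ncvg d_ v.
Proof.
have [M bM] := b_bounded.
apply: (approx_of_orthogonal0 bh alpha0 b_coercive bM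
  (D := [set u | op_dom A (j u)])).
  split=> [|c u w Du Dw] /=; first by rewrite linear0; exact: op_dom0.
  by rewrite linearP; exact: op_domP.
move=> w w0; apply: embedding_injective; rewrite linear0.
apply: inner_eq0 => f; have [u uf] := b_represents f.
rewrite -uf bh.2 w0 ?rmorph0//=.
suff [] : op_dom A (j u) /\ A (j u) = s%:C *: (f - omega%:C *: j u) by [].
apply: op_of_form => v'.
have := uf v'; rewrite bh.2 iH.2 => /(congr1 (@Num.conj R[i])); rewrite !conjCK.
rewrite (hermitianZl iH) (hermitianBl iH) (hermitianZl iH) => <-.
by rewrite /b addrK mulrA -rmorphM ss mul1r.
Qed.

(** Solving with right-hand side [s g] gives [A (j u) = s (s g - omega j u)], that is
    [(A + s omega) (j u) = g]. *)
Lemma op_selfadjoint : selfadjoint A.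
Proof.
apply: (selfadjoint_of_surjective (k := s * omega)).
  move=> _ _ /op_domE[u -> au] /op_domE[v -> av].
  by rewrite -au ah.2 av -iH.2.
move=> g; have [u uf] := b_represents (s%:C *: g).
have [Du Au] : op_dom A (j u) /\ A (j u) = s%:C *: (s%:C *: g - omega%:C *: j
  u).
  apply: op_of_form => v.
  have := uf v; rewrite bh.2 iH.2 => /(congr1 (@Num.conj R[i]));
    rewrite !conjCK.
  rewrite (hermitianZl iH _ (_ - _)) (hermitianBl iH) (hermitianZl iH omega%:C)
    => <-.
  by rewrite /b addrK mulrA -rmorphM ss mul1r.
exists (j u) => //; rewrite Au scalerBr !scalerA -!rmorphM ss scale1r.
by rewrite subrK.
Qed.

Lemma op_semibounded : semibounded A.
Proof.
have aE u : op_dom A (j u) -> inner (A (j u)) (j u) = (ra u u)%:C.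
  by move=> Du; rewrite -(op_form u Du) (hermitian_diag ah).
have ge0 u : 0 <= s * ra u u + omega * nrm (j u) ^+ 2.
  by apply: le_trans (a_coercive u); rewrite mulr_ge0 ?sqr_ge0// ltW.
case: sP => sE; [left; exists (- omega)|right; exists omega];
  move=> x Dx; have [u xu _] := op_domE Dx; move: Dx; rewrite xu => Dx;
  rewrite aE// nrmE -rmorphXn -rmorphM lecR; have := ge0 u; rewrite sE; lra.
Qed.

End Resolvent.

Lemma form_core v : exists2 d_ : nat -> V,
  (forall n, op_dom A (j (d_ n))) & ncvg d_ v.
Proof.
have [s [omega [alpha [sP al0 aP]]]] := form_semicoercive.
exact: form_domain_approx sP al0 aP v.
Qed.

Lemma selfadjoint_of_form : selfadjoint A /\ semibounded A.
Proof.
have [s [omega [alpha [sP al0 aP]]]] := form_semicoercive.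
by split; [exact: op_selfadjoint sP al0 aP|exact: op_semibounded sP al0 aP].
Qed.

End FormOfOperator.

(** * Uniqueness of the form *)

Section TwoForms.
Context {R : realType} {H : hilbertType R}.
Variables (A : operator H) (V1 V2 : hilbertType R).
Variables (j1 : {linear V1 -> H}) (j2 : {linear V2 -> H}).
Variables (a1 : {sesquilinear V1}) (a2 : {sesquilinear V2}).
Hypothesis A1 : form_of_operator A j1 a1.
Hypothesis A2 : form_of_operator A j2 a2.

(** On the domain of [A] both forms equal [<A x, x>] on the diagonal, so semicoercivity of [a1] and
    the bounds on [a2] and [j2] control the first norm by the second. *)
Lemma form_norm_le : exists2 C : R, 0 < C & forall u1 u2,
  j1 u1 = j2 u2 -> op_dom A (j1 u1) -> nrm u1 <= C * nrm u2.
Proof.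
have [s [omega [alpha [sP al0 aP]]]] := form_semicoercive A1.
have [M M0 aM] := form_bounded A2; have [K K0 jK] := embedding_bounded A2.
have D0 : 0 < M + `|omega| * K ^+ 2 by rewrite ltr_pwDl// mulr_ge0// sqr_ge0.
pose C := (M + `|omega| * K ^+ 2) / alpha.
(* [C] compares squared norms; [C <= (C + 1)^2] avoids a square root. *)
exists (C + 1) => [|u1 u2 u12 Du]; first by rewrite addr_gt0// divr_gt0.
have aE : a1 u1 u1 = a2 u2 u2.
  by rewrite (op_form A1)// u12 (op_form A2)// -u12.
have C0 : 0 < C by rewrite divr_gt0.
rewrite -(@ler_pXn2r _ 2) ?nnegrE ?mulr_ge0 ?nrm_ge0// ?addr_ge0// ?(ltW C0)//.
have h : alpha * nrm u1 ^+ 2 <= (M + `|omega| * K ^+ 2) * nrm u2 ^+ 2.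
  apply: le_trans (aP u1) _; rewrite aE u12 mulrDl lerD//.
    have := aM u2 u2; rewrite -expr2; apply: le_trans.
    by case: sP => ->; rewrite ?mul1r ?mulN1r ?ler_norm// -normrN ler_norm.
  apply: (@le_trans _ _ (`|omega| * nrm (j2 u2) ^+ 2)).
    by rewrite ler_wpM2r ?sqr_ge0// ler_norm.
  rewrite -mulrA ler_wpM2l// -exprMn ler_pXn2r// nnegrE ?nrm_ge0//.
  by rewrite mulr_ge0 ?nrm_ge0// ltW.
have {h} h : nrm u1 ^+ 2 <= C * nrm u2 ^+ 2.
  by rewrite /C mulrAC ler_pdivlMr// mulrC.
apply: le_trans h _; rewrite exprMn ler_wpM2r ?sqr_ge0//.
by move: (C) C0 => c c0; have := sqr_ge0 c; lra.
Qed.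

(** Domain vectors approximating [v2] in [V2] are Cauchy in [V1] by [form_norm_le], and continuity
    of the embeddings identifies the two limits in [H]. The sequences are kept in order to compare
    the forms. *)
Lemma form_transfer : exists2 C : R, 0 < C & forall v2, exists v1,
  [/\ j1 v1 = j2 v2, nrm v1 <= C * nrm v2
    & exists (u1 : nat -> V1) (u2 : nat -> V2),
        [/\ forall n, op_dom A (j1 (u1 n)), forall n, j1 (u1 n) = j2 (u2 n),
            ncvg u1 v1 & ncvg u2 v2]].
Proof.
have [C C0 le_C] := form_norm_le; exists C => // v2.
have [u2 Du2 u2v] := form_core A2 v2.
have /choice[u1 u12] n : exists u, j1 u = j2 (u2 n).
  by have [u -> _] := op_domE A1 (Du2 n); exists u.
have Du1 n : op_dom A (j1 (u1 n)) by rewrite u12.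
have [v1 u1v] : exists v, ncvg u1 v.
  have u2v' : (fun n => C * nrm (u2 n - v2)) @ \oo --> 0.
    by rewrite -(mulr0 C); exact: cvgMl_tmp.
  apply: (ncauchy_cvg u2v') => m n.
  have := le_C (u1 m - u1 n) (u2 m - u2 n).
  rewrite !linearB !u12 => /(_ erefl (op_domB (Du2 m) (Du2 n))) /le_trans;
    apply.
  by rewrite -mulrDr ler_pM2l// (nrm_distC (u2 n)) nrm_dist.
have [K1 _ jK1] := embedding_bounded A1; have [K2 _ jK2] := embedding_bounded
  A2.
exists v1; split; last by exists u1, u2.
  apply: (@ncvg_unique _ _ (j1 \o u1)).
    apply: (cvg_dominated (K := K1) u1v) => n.
    by rewrite subr0 ger0_norm ?nrm_ge0// /= -linearB.
  apply: (cvg_dominated (K := K2) u2v) => n.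
  by rewrite subr0 ger0_norm ?nrm_ge0// /= u12 -linearB.
apply: (ler_cvg_to (ncvg_nrm u1v) (cvgMl_tmp (a := C) (ncvg_nrm u2v))).
by apply: nearW => n; exact: le_C.
Qed.

End TwoForms.

Lemma form_unique (R : realType) (H : hilbertType R) (A : operator H)
    (V1 V2 : hilbertType R) (j1 : {linear V1 -> H}) (j2 : {linear V2 -> H})
    (a1 : {sesquilinear V1}) (a2 : {sesquilinear V2}) :
  form_of_operator A j1 a1 -> form_of_operator A j2 a2 -> same_form j1 a1 j2 a2.
Proof.
move=> A1 A2.
have [C12 C120 T12] := form_transfer A1 A2.
have [C21 C210 T21] := form_transfer A2 A1.
have le12 v1 v2 : j1 v1 = j2 v2 -> nrm v1 <= C12 * nrm v2.
  by have [w [<- h _]] := T12 v2 => /(embedding_injective A1) ->.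
have le21 v1 v2 : j1 v1 = j2 v2 -> nrm v2 <= C21 * nrm v1.
  by have [w [<- h _]] := T21 v1 => /(embedding_injective A2) <-.
have [h1 h2] := (form_hermitian A1, form_hermitian A2).
(* Approximating the first argument is enough: for [x] in the domain of [A], both forms at [(x, v)]
   equal [<A x, v>] for every [v] of the form domain. *)
have ReE u1 v1 u2 v2 : j1 u1 = j2 u2 -> j1 v1 = j2 v2 ->
    complex.Re (a1 u1 v1) = complex.Re (a2 u2 v2).
  move=> u12 v12.
  have [u [+ _ [x1 [x2 [Dx x12 x1u x2u]]]]] := T12 u2.
  rewrite -u12 => /(embedding_injective A1) uE; rewrite {}uE in x1u.
  have [M1 _ aM1] := form_bounded A1; have [M2 _ aM2] := form_bounded A2.
  apply: (@cvg_real_unique _ (fun n => complex.Re (a1 (x1 n) v1))).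
    apply: (cvg_dominated (K := M1 * nrm v1) x1u) => n.
    by rewrite -ReN -ReD -(hermitianBl h1) -mulrA (mulrC (nrm v1)).
  apply: (cvg_dominated (K := M2 * nrm v2) x2u) => n.
  rewrite (op_form A1)// x12 v12 -(op_form A2) -?x12//.
  by rewrite -ReN -ReD -(hermitianBl h2) -mulrA (mulrC (nrm v2)).
split.
- apply/seteqP; split=> [_ [v _ <-]|_ [v _ <-]].
    by have [w [<- _ _]] := T21 v; exists w.
  by have [w [<- _ _]] := T12 v; exists w.
- exists C12^-1, C21; split; rewrite ?invr_gt0// => v1 v2 v12.
  rewrite !nrmE -!rmorphM !lecR le21// andbT.
  by rewrite ler_pdivrMl// le12.
move=> u1 v1 u2 v2 u12 v12; apply: complex_eqP; first exact: ReE.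
apply: oppr_inj; rewrite -(Re_hermitianZi h1) -(Re_hermitianZi h2).
by apply: ReE => //; rewrite !linearZ u12.
Qed.

Theorem theorem8p2 (R : realType) (H : hilbertType R) (A : operator H) :
  ((selfadjoint A /\ semibounded A) <->
   (exists (V : hilbertType R) (j : {linear V -> H}) (a : {sesquilinear V}),
      form_of_operator A j a)) /\
  (forall (V1 V2 : hilbertType R) (j1 : {linear V1 -> H})
      (j2 : {linear V2 -> H}) (a1 : {sesquilinear V1}) (a2 : {sesquilinear V2}),
    form_of_operator A j1 a1 -> form_of_operator A j2 a2 ->
    same_form j1 a1 j2 a2).
Proof.
split; last by move=> V1 V2 j1 j2 a1 a2; exact: form_unique.
split; first by case=> Asa; exact: form_of_selfadjoint.
by move=> [V [j [a Aa]]]; exact: selfadjoint_of_form Aa.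
Qed.
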